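(* Let $G\rightrightarrows M$, $G'\rightrightarrows M'$ and $K\rightrightarrows N$ be Lie groupoids and let $\phi:K\to G$ and $\psi:K\to G'$ be Morita maps whose maps on objects $\phi^0:N\to M$ and $\psi^0:N\to M'$ are surjective submersions. Consider the isomorphism $$\mathrm{Hom}(G',\mathbb{R})\to \mathrm{Hom}(G,\mathbb{R}),\qquad F'=s^*f'\mapsto F=s^*f,$$ where $f\in C^\infty(M)^G$ is the unique basic function with $f\circ\phi^0=f'\circ\psi^0$. Then this isomorphism preserves Morse Lie groupoid morphisms, i.e. it carries Morse Lie groupoid morphisms on $G'$ to Morse Lie groupoid morphisms on $G$.
   Context: A Lie groupoid $G\rightrightarrows M$ has manifold of arrows $G$, manifold of objects $M$, and source and target $s,t:G\to M$ which are surjective submersions. The orbit of $x\in M$ is $\mathcal{O}_x=\{t(g): s(g)=x\}$. A Lie groupoid morphism is a pair $\phi=(\phi^1,\phi^0)$ of smooth maps on arrows and objects compatible with source, target and composition. A Morita map $\phi:(G\rightrightarrows M)\to(G'\rightrightarrows M')$ is a morphism which is fully faithful (source and target define a fibred product of manifolds $G\cong (M\times M)\times_{(M'\times M')}G'$) and essentially surjective (the map $G'\times_{M'}M\to M'$ sending $(\phi^0(x)\to y,\,x)\mapsto y$ is a surjective submersion). $C^\infty(M)^G=\{f\in C^\infty(M): s^*f=t^*f\}$ is the space of basic functions. $\mathrm{Hom}(G,\mathbb{R})$ denotes the set of Lie groupoid morphisms from $G\rightrightarrows M$ to the unit groupoid $\mathbb{R}\rightrightarrows\mathbb{R}$; each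 is of the form $F=s^*f=t^*f$ for a unique basic $f$ (''$F$ covers $f$''). It is known that, for $\phi,\psi$ as in the claim, for each $f'\in C^\infty(M')^{G'}$ there is a unique $f\in C^\infty(M)^G$ with $f\circ\phi^0=f'\circ\psi^0$, and $f'\mapsto f$ is an isomorphism. If $x$ is a critical point of a basic function $f$, then all points of $\mathcal{O}_x$ are critical; such an orbit is a critical orbit. A critical orbit $\mathcal{O}$ is non-degenerate if for every $x\in\mathcal{O}$ the Hessian $\mathcal{H}_x(f)$ induces a non-degenerate bilinear form on $\nu_x(\mathcal{O})=T_xM/T_x\mathcal{O}$ (equivalently $\ker\mathcal{H}_x(f)=T_x\mathcal{O}$). A Lie groupoid morphism $F:G\to\mathbb{R}$ covering $f$ is a Morse Lie groupoid morphism if every critical orbit of $f$ is non-degenerate. *)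

(* Defs.v *)
From mathcomp Require Import all_boot all_order all_algebra.
From mathcomp Require Import all_classical all_reals all_analysis.
From mathcomp Require Import lra.

Set Implicit Arguments.
Unset Strict Implicit.
Unset Printing Implicit Defensive.

Import Order.TTheory GRing.Theory Num.Theory.
Import numFieldNormedType.Exports.

Local Open Scope classical_set_scope.
Local Open Scope ring_scope.

(* A map is C^(k+1) on an open set iff it is differentiable there and all its
   directional derivatives are C^k. *)
Fixpoint Ck_on {R : realType} {m n : nat} (k : nat) (U : set 'rV[R]_m)
    (f : 'rV[R]_m -> 'rV[R]_n) : Prop :=
  if k is k'.+1 then
    (forall x, U x -> differentiable f x) /\ (forall v, Ck_on k' U ('D_v f))
  else forall x, U x -> {for x, continuous f}.

Definition smooth_on {R : realType} {m n : nat} (U : set 'rV[R]_m)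
    (f : 'rV[R]_m -> 'rV[R]_n) : Prop :=
  forall k, Ck_on k U f.

(* [chart_inv] is only meaningful on [chart_map @` chart_dom]. *)
Record chart (R : realType) (T : topologicalType) (n : nat) := Chart {
  chart_dom : set T;
  chart_map :> T -> 'rV[R]_n;
  chart_inv : 'rV[R]_n -> T;
  chart_dom_open : open chart_dom;
  chart_img_open : open (chart_map @` chart_dom);
  chart_mapK : forall x, chart_dom x -> chart_inv (chart_map x) = x;
  chart_map_continuous :
    forall x, chart_dom x -> {for x, continuous chart_map};
  chart_inv_continuous :
    forall y, (chart_map @` chart_dom) y -> {for y, continuous chart_inv} }.

(* Hausdorff, second countable, without boundary, of constant finite dimension.
   [chart_at] singles out, for each point, the chart used to write tangent
   vectors, differentials and Hessians at that point; the notions defined from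
   it below (critical points, submersions, kernels of Hessians, ...) do not
   depend on this choice, by the chain rule. *)
Record manifold (R : realType) := Manifold {
  carrier :> topologicalType;
  dim : nat;
  atlas : set (chart R carrier dim);
  chart_at : carrier -> chart R carrier dim;
  chart_at_atlas : forall x, atlas (chart_at x);
  mem_chart_at : forall x, chart_dom (chart_at x) x;
  atlas_compatible : forall c d, atlas c -> atlas d ->
    smooth_on (c @` (chart_dom c `&` chart_dom d)) (d \o chart_inv c);
  manifold_hausdorff : hausdorff_space carrier;
  manifold_second_countable : @second_countable carrier }.

Definition smooth {R : realType} {M N : manifold R} (F : M -> N) : Prop :=
  continuous F /\
  forall c d, atlas c -> atlas d ->
    smooth_on (c @` (chart_dom c `&` F @^-1` chart_dom d))
              (d \o F \o chart_inv c).

(* T_x M, in the coordinates of [chart_at x] *)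
Definition tangent {R : realType} (M : manifold R) (x : M) : Type :=
  'rV[R]_(dim M).

Definition differential {R : realType} {M N : manifold R} (F : M -> N) (x : M) :
    tangent x -> tangent (F x) :=
  'd (chart_at (F x) \o F \o chart_inv (chart_at x)) (chart_at x x).

Arguments differential {R M N} F x v.

Definition surjective_submersion {R : realType} {M N : manifold R}
    (F : M -> N) : Prop :=
  [/\ smooth F, (forall y, exists x, F x = y) &
      forall (x : M) (w : tangent (F x)), exists v, differential F x v = w].

(* P, with its two projections, is the fibred product A x_C B of manifolds. *)
Definition fibred_product {R : realType} {A B C P : manifold R}
    (f : A -> C) (g : B -> C) (p : P -> A) (q : P -> B) : Prop :=
  [/\ smooth p, smooth q, (forall z, f (p z) = g (q z)) &
      forall (Z : manifold R) (a : Z -> A) (b : Z -> B),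
        smooth a -> smooth b -> (forall z, f (a z) = g (b z)) ->
        exists! h : Z -> P, [/\ smooth h, p \o h = a & q \o h = b]].

(* [mul g h] is the composite "g after h"; it is only meaningful when
   [source g = target h]. *)
Record lie_groupoid (R : realType) := LieGroupoid {
  arrows : manifold R;
  objects : manifold R;
  source : arrows -> objects;
  target : arrows -> objects;
  unit_at : objects -> arrows;
  inverse : arrows -> arrows;
  mul : arrows -> arrows -> arrows;
  source_submersion : surjective_submersion source;
  target_submersion : surjective_submersion target;
  unit_smooth : smooth unit_at;
  inverse_smooth : smooth inverse;
  mul_smooth : exists (P : manifold R) (p q : P -> arrows),
    fibred_product source target p q /\ smooth (fun z => mul (p z) (q z));
  source_unit : forall x, source (unit_at x) = x;
  target_unit : forall x, target (unit_at x) = x;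
  source_inverse : forall g, source (inverse g) = target g;
  target_inverse : forall g, target (inverse g) = source g;
  source_mul : forall g h, source g = target h -> source (mul g h) = source h;
  target_mul : forall g h, source g = target h -> target (mul g h) = target g;
  mul_assoc : forall g h k, source g = target h -> source h = target k ->
    mul g (mul h k) = mul (mul g h) k;
  mul_unit_l : forall g, mul (unit_at (target g)) g = g;
  mul_unit_r : forall g, mul g (unit_at (source g)) = g;
  mul_inverse_l : forall g, mul (inverse g) g = unit_at (source g);
  mul_inverse_r : forall g, mul g (inverse g) = unit_at (target g) }.

Arguments source {R l}.
Arguments target {R l}.
Arguments unit_at {R l}.
Arguments inverse {R l}.
Arguments mul {R l}.

Definition orbit_of {R : realType} {G : lie_groupoid R} (x : objects G) :
    set (objects G) :=
  [set y | exists g, source g = x /\ target g = y].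

(* The immersed submanifold structure of the orbit through x is the one making
   t : s^-1(x) -> O_x a submersion, so T_x O_x = dt (ker ds) at the unit of x.
   Coordinates match since [target (unit_at x) = x]. *)
Definition tangent_orbit {R : realType} {G : lie_groupoid R} (x : objects G) :
    set (tangent x) :=
  [set v | exists u : tangent (unit_at x),
     differential source (unit_at x) u = 0 :> 'rV[R]_(dim (objects G)) /\
     differential target (unit_at x) u = v :> 'rV[R]_(dim (objects G))].

Arguments tangent_orbit {R G} x v.

Record lie_morphism {R : realType} (G H : lie_groupoid R) := LieMorphism {
  on_arrows : arrows G -> arrows H;
  on_objects : objects G -> objects H;
  on_arrows_smooth : smooth on_arrows;
  on_objects_smooth : smooth on_objects;
  on_source : forall g, source (on_arrows g) = on_objects (source g);
  on_target : forall g, target (on_arrows g) = on_objects (target g);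
  on_mul : forall g h, source g = target h ->
    on_arrows (mul g h) = mul (on_arrows g) (on_arrows h) }.

(* G is the fibred product (M x M) x_(M' x M') G' in the category of manifolds;
   smooth maps into M x M are written as pairs of smooth maps into M. *)
Definition fully_faithful {R : realType} {G G' : lie_groupoid R}
    (phi : lie_morphism G G') : Prop :=
  forall (Z : manifold R) (a b : Z -> objects G) (c : Z -> arrows G'),
    smooth a -> smooth b -> smooth c ->
    (forall z, on_objects phi (a z) = source (c z)) ->
    (forall z, on_objects phi (b z) = target (c z)) ->
    exists! h : Z -> arrows G,
      [/\ smooth h, source \o h = a, target \o h = b & on_arrows phi \o h = c].

Definition essentially_surjective {R : realType} {G G' : lie_groupoid R}
    (phi : lie_morphism G G') : Prop :=
  exists (P : manifold R) (p : P -> arrows G') (q : P -> objects G),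
    fibred_product source (on_objects phi) p q /\
    surjective_submersion (target \o p).

Definition morita_map {R : realType} {G G' : lie_groupoid R}
    (phi : lie_morphism G G') : Prop :=
  fully_faithful phi /\ essentially_surjective phi.

Lemma smooth_id {R : realType} (M : manifold R) : smooth (@id M).
Proof.
split; first by move=> x; exact: cvg_id.
by move=> c d ac ad; exact: (atlas_compatible ac ad).
Qed.

Lemma diff_near_id {R : realType} {n : nat} (h : 'rV[R]_n -> 'rV[R]_n) a :
  (\forall y \near a, h y = y) -> 'd h a = id :> ('rV[R]_n -> 'rV[R]_n).
Proof.
move=> ha; apply: (@diff_unique _ _ _ h idfun); first by move=> x; exact: cvg_id.
apply/eqaddoP => e e0 /=.
have : \forall y \near (0 : 'rV[R]_n), h (y + a) = y + a.
  have ca : {for (0 : 'rV[R]_n), continuous (id \+ cst a)}.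
    by apply: continuousD; [exact: cvg_id | exact: cst_continuous].
  by rewrite /prop_for /continuous_at /= add0r in ca; exact: ca ha.
apply: filterS => y hy; rewrite /= !fctE /= hy (nbhs_singleton ha).
by rewrite [a + y]addrC subrr normr0 mulr_ge0 // ltW.
Qed.

Lemma differential_id {R : realType} (M : manifold R) (x : M) (v : tangent x) :
  differential id x v = v.
Proof.
rewrite /differential diff_near_id //=.
set c := chart_at x; have dx : chart_dom c x by exact: mem_chart_at.
apply: (@filterS _ _ _ (c @` chart_dom c)).
  by move=> _ [z dz <-]; rewrite /= chart_mapK.
apply: open_nbhs_nbhs; split; first exact: chart_img_open.
by exists x.
Qed.

Lemma surjective_submersion_id {R : realType} (M : manifold R) :
  surjective_submersion (@id M).
Proof.
split; [exact: smooth_id | by move=> y; exists y |].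
by move=> x w; exists w; exact: differential_id.
Qed.

Lemma fibred_product_id {R : realType} (M : manifold R) :
  fibred_product (@id M) (@id M) (@id M) (@id M).
Proof.
split; [exact: smooth_id | exact: smooth_id | by [] |].
move=> Z a b sa _ ab; exists a; split; last by move=> h [].
by split=> //; apply/funext => z; rewrite /= -ab.
Qed.

Program Definition unit_groupoid {R : realType} (M : manifold R) :
    lie_groupoid R :=
  @LieGroupoid R M M id id id id (fun x _ => x)
    (surjective_submersion_id M) (surjective_submersion_id M)
    (smooth_id M) (smooth_id M) _ _ _ _ _ _ _ _ _ _ _ _.
Next Obligation.
move=> R M; exists M, id, id.
by split; [exact: fibred_product_id | exact: smooth_id].
Qed.
Solve Obligations with by [].


Lemma second_countable_real (R : realType) : @second_countable R.
Proof.
pose B (p : rat * rat) : set R := ball (ratr p.1 : R) (ratr p.2).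
exists (B @` setT); first exact: sub_countable (card_image_le _ _) (countableP _).
split.
  move=> _ [p _ <-]; rewrite /B; have [p0|p0] := ltP 0 (ratr p.2 : R).
    exact: ball_open.
  rewrite (_ : ball _ _ = set0); first exact: open0.
  rewrite -subset0 => y; rewrite /ball /= => yp.
  by have := le_lt_trans (normr_ge0 _) yp; rewrite ltNge p0.
move=> x A /nbhs_ballP[e /= e0 eA].
have [q] := @rat_in_itvoo R 0 (e / 2) ltac:(by rewrite divr_gt0).
rewrite in_itv /= => /andP[q0 qe].
have [p] := @rat_in_itvoo R (x - ratr q) (x + ratr q)
  ltac:(by rewrite ltrD2l gtrN).
rewrite in_itv /= => /andP[px xp].
have Bx : ball (ratr p : R) (ratr q) x.
  by rewrite /ball /= ltr_distlC; apply/andP; split; lra.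
exists (B (p, q)); first by split => //; exists (p, q).
move=> y; rewrite /B /= => yB; apply: eA; rewrite /ball /=.
move: Bx yB; rewrite /ball /= => Bx yB.
rewrite (le_lt_trans (ler_distD (ratr p) _ _)) // distrC.
lra.
Qed.

Lemma continuous_const_mx (R : realType) :
  continuous (fun r : R => const_mx r : 'rV[R]_1).
Proof.
move=> r; apply/cvg_ballP => e e0; near=> s; split=> // i j; rewrite !mxE.
by near: s; exact: (@nbhsx_ballx _ _ r e e0).
Unshelve. all: by end_near. Qed.

Program Definition real_chart (R : realType) : chart R R 1 :=
  @Chart R R 1 setT (fun r => const_mx r) (fun v => v 0 0) _ _ _ _ _.
Next Obligation. by move=> R; exact: openT. Qed.
Next Obligation.
move=> R; rewrite (_ : _ @` _ = setT); first exact: openT.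
apply/seteqP; split=> // v _; exists (v 0 0) => //.
by apply/rowP => i; rewrite mxE ord1.
Qed.
Next Obligation. by move=> R x _; rewrite /= mxE. Qed.
Next Obligation. by move=> R x _; exact: continuous_const_mx. Qed.
Next Obligation. by move=> R y _; exact: coord_continuous. Qed.

Lemma smooth_on_cst {R : realType} {m n} (U : set 'rV[R]_m) (a : 'rV[R]_n) :
  smooth_on U (cst a).
Proof.
move=> k; elim: k a => [|k IH] a /=; first by move=> x _; exact: cst_continuous.
split=> [x _|v]; first exact: differentiable_cst.
rewrite (_ : 'D_v (cst a) = cst 0); first exact: IH.
by apply/funext => x; rewrite derive_cst.
Qed.

Lemma smooth_on_id {R : realType} {m} (U : set 'rV[R]_m) : smooth_on U id.
Proof.
case=> [|k] /=; first by move=> x _; exact: cvg_id.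
split=> [x _|v]; first exact: (@ex_diff _ _ _ _ _ _ _ (is_diff_id x)).
rewrite (_ : 'D_v id = cst v); first exact: smooth_on_cst.
by apply/funext => x; rewrite derive_id.
Qed.

Program Definition real_line (R : realType) : manifold R :=
  @Manifold R R 1 [set real_chart R] (fun _ => real_chart R) _ _ _ _ _.
Next Obligation. by []. Qed.
Next Obligation. by []. Qed.
Next Obligation.
move=> R c d -> ->; rewrite (_ : _ \o _ = id); first exact: smooth_on_id.
by apply/funext => v; apply/rowP => i; rewrite /= mxE ord1.
Qed.
Next Obligation. by move=> R; exact: Rhausdorff. Qed.
Next Obligation. exact: second_countable_real. Qed.

Definition critical_point {R : realType} {M : manifold R}
    (f : M -> real_line R) (x : M) : Prop :=
  forall v : tangent x, differential f x v = 0 :> 'rV[R]_1.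

(* Second directional derivatives in the coordinates of [chart_at x]; at a
   critical point this is the intrinsic Hessian form on T_x M. *)
Definition hessian {R : realType} {M : manifold R} (f : M -> R) (x : M)
    (v w : tangent x) : R :=
  'D_v ('D_w (f \o chart_inv (chart_at x))) (chart_at x x).

Arguments hessian {R M} f x v w.

Definition critical_orbit {R : realType} {G : lie_groupoid R}
    (f : objects G -> real_line R) (O : set (objects G)) : Prop :=
  exists2 x, critical_point f x & O = orbit_of x.

(* Non-degeneracy of the form induced on T_x M / T_x O, i.e.
   ker (Hessian at x) = T_x O. *)
Definition nondegenerate_orbit {R : realType} {G : lie_groupoid R}
    (f : objects G -> real_line R) (O : set (objects G)) : Prop :=
  forall x, O x ->
    [set v : tangent x | forall w : tangent x, hessian f x v w = 0] =
    tangent_orbit x.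

Definition real_morphism {R : realType} (G : lie_groupoid R) : Type :=
  lie_morphism G (unit_groupoid (real_line R)).

Definition covered {R : realType} {G : lie_groupoid R} (F : real_morphism G) :
    objects G -> real_line R :=
  on_objects F.

Definition morse {R : realType} {G : lie_groupoid R} (F : real_morphism G) :
    Prop :=
  forall O, critical_orbit (covered F) O -> nondegenerate_orbit (covered F) O.

(* Main.v *)
Require Import Defs.
From mathcomp Require Import all_boot all_order all_algebra.
From mathcomp Require Import all_classical all_reals all_analysis.
From HB Require Import structures.
From mathcomp Require Import ring lra.

(** Write [f], [f'] for the functions covered by [F], [F'], and let [h] be the
common pullback [f o phi0 = f' o psi0] on the objects of K. Since [phi0] and
[psi0] are surjective submersions, a point [n] is critical for [h] iff [phi0 n]
is critical for [f] iff [psi0 n] is critical for [f'].  At a critical point the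
Hessian is pulled back like a bilinear form ([hessian_comp]), so the three
Hessian kernels correspond to each other under the differentials of [phi0] and
[psi0].  It remains to compare them with the tangent spaces of the orbits.

The inclusion of the orbit directions in the kernel holds for every basic
function: [f o source = f o target], and a vector tangent to the orbit is
[dt u] with [ds u = 0], so the Hessian of [f] at [dt u] is the Hessian of
[f o source] at [u], which vanishes.  The same equation of functions shows that
all points of the orbit of a critical point are critical.

For the converse, lift a vector in the kernel for [f] to a vector [v] at [n].
Its image under [psi0] is in the kernel for [f'], hence tangent to an orbit of
G' because [F'] is Morse.  Full faithfulness of [psi] makes [v] tangent to an
orbit of K ([tangent_orbit_lift]), and [phi] then maps it to a vector tangent to
an orbit of G ([tangent_orbit_push]).

The substance is [tangent_orbit_lift].  Full faithfulness is a universal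
property, so it only produces tangent vectors of the arrow manifold of K out of
actual smooth families.  Given [u] with [ds u = 0] and [dt u = d psi0 v], take a
curve of arrows of G' with velocity [u], and lift its source and its target
through the submersion [psi0] to curves of objects of K from [n] with velocities
[0] and [v], up to a common factor ([lift_curve]).  The universal property yields a curve of arrows of
K through the unit at [n], and its velocity shows that [v] is tangent to the
orbit.

Lifting curves rests on the inverse function theorem ([local_inverse]): with
[L] a right inverse of [dq], the map
  [Phi z = (z - a) + L (q z - q a - dq (z - a))]
has identity differential at [a] and satisfies
[dq (Phi z) = q z - q a], so a local inverse of [Phi] straightens the submersion
[q] to its differential ([submersion_straightening]).  The universal
property is applied to families over the real line, so local curves are
reparametrized by [t |-> d t / (1 + t^2)], which has values in a small interval. *)

Set Implicit Arguments.
Unset Strict Implicit.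
Unset Printing Implicit Defensive.

Import Order.TTheory GRing.Theory Num.Theory.
Import numFieldNormedType.Exports.
Import Defs.

Local Open Scope classical_set_scope.
Local Open Scope ring_scope.

(** * Calculus of C^k maps between open sets of row vectors *)

Lemma near_translate {R : realType} {V : normedModType R} (x : V) (P : set V) :
  (\forall y \near x, P y) -> \forall h \near (0 : V), P (h + x).
Proof.
have ca : {for (0 : V), continuous (id \+ cst x)}.
  by apply: continuousD; [exact: cvg_id | exact: cst_continuous].
by rewrite /prop_for /continuous_at /= add0r in ca; exact: ca.
Qed.

Lemma differentiable_id {R : realType} {V : normedModType R} (x : V) :
  differentiable (id : V -> V) x.
Proof. exact: (@ex_diff _ _ _ _ _ _ _ (is_diff_id x)). Qed.

Section differentiability.
Context {R : realType} {V W : normedModType R}.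

(** The epsilon form of the definition, in which a candidate for the
differential can be tested without the Landau notations. *)
Lemma differentiable_eps (f : V -> W) (df : {linear V -> W}) (x : V) :
  continuous df ->
  (forall e, 0 < e -> \forall h \near (0 : V),
     `|f (h + x) - (f x + df h)| <= e * `|h|) ->
  differentiable f x /\ 'd f x = df :> (V -> W).
Proof.
move=> cdf H.
have E : f \o shift x = cst (f x) + df +o_ (0 : V) id.
  apply/eqaddoP => e e0; exact: (H e e0).
have D := diff_unique cdf E; split => //.
apply/diff_locallyP; split; first by rewrite D.
by rewrite D.
Qed.

Lemma diff_eps (f : V -> W) (x : V) e : differentiable f x -> 0 < e ->
  \forall h \near (0 : V), `|f (h + x) - (f x + 'd f x h)| <= e * `|h|.
Proof. by move=> /diff_locallyP[_ /eqaddoP H] e0; exact: (H e e0). Qed.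

Lemma near_eq_differentiable (f g : V -> W) (x : V) :
  (\forall y \near x, f y = g y) -> differentiable f x ->
  differentiable g x /\ 'd g x = 'd f x :> (V -> W).
Proof.
move=> fg df; apply: differentiable_eps; first exact: diff_continuous.
move=> e e0.
have := near_translate fg.
move: (diff_eps df e0); apply: filterS2 => h H E.
by rewrite -E -(nbhs_singleton fg).
Qed.

End differentiability.

Section Ck_basics.
Context {R : realType} {m n : nat}.
Implicit Types (U V : set 'rV[R]_m) (f g : 'rV[R]_m -> 'rV[R]_n).

Lemma Ck_on_sub k U V f : V `<=` U -> Ck_on k U f -> Ck_on k V f.
Proof.
move=> VU; elim: k f => [|k IH] f /=; first by move=> H x /VU; exact: H.
by case=> H1 H2; split=> [x /VU|v]; [exact: H1|exact: IH].
Qed.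

(** Being C^k on a set refers only to the behaviour of the map near each of its
points. *)
Lemma Ck_on_local k U f :
  (forall x, U x -> exists2 V, V x & Ck_on k V f) -> Ck_on k U f.
Proof.
elim: k f => [|k IH] f /= H; first by move=> x /H[V Vx]; exact.
split=> [x /H[V Vx [+ _]]|v]; first exact.
by apply: IH => x /H[V Vx [_ /(_ v)]]; exists V.
Qed.

Lemma Ck_onW k U f : Ck_on k.+1 U f -> Ck_on k U f.
Proof.
elim: k f => [|k IH] f [H1 H2].
  by move=> x /H1 /differentiable_continuous.
by split=> // v; exact: IH.
Qed.

(** Openness is what makes this true: derivatives at a point of [U] see the
values in a neighbourhood. *)
Lemma eq_Ck_on k U f g : open U -> (forall x, U x -> f x = g x) ->
  Ck_on k U f -> Ck_on k U g.
Proof.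
move=> oU.
have N x : U x -> \forall y \near x, U y by move=> Ux; exact: open_nbhs_nbhs.
elim: k f g => [|k IH] f g fg /=.
  move=> H x Ux; rewrite /prop_for /continuous_at -(fg x Ux).
  have E : {near nbhs x, f =1 g} by apply: filterS (N _ Ux) => y; exact: fg.
  exact: cvg_trans (near_eq_cvg E) (H x Ux).
case=> H1 H2; split=> [x Ux|v].
  apply: (near_eq_differentiable _ (H1 x Ux)).1.
  by apply: filterS (N _ Ux) => y; exact: fg.
apply: IH (H2 v) => x Ux; apply: near_eq_derive.
by apply: filterS (N _ Ux) => y; exact: fg.
Qed.

Lemma Ck_onD k U f g : open U ->
  Ck_on k U f -> Ck_on k U g -> Ck_on k U (fun x => f x + g x).
Proof.
move=> oU; elim: k f g => [|k IH] f g /=.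
  by move=> Hf Hg x Ux; apply: continuousD; [exact: Hf|exact: Hg].
case=> Hf Kf [Hg Kg]; split=> [x Ux|v].
  by apply: differentiableD; [exact: Hf|exact: Hg].
apply: eq_Ck_on (IH _ _ (Kf v) (Kg v)) => // x Ux.
by rewrite [RHS]deriveD//; apply/diff_derivable; [exact: Hf|exact: Hg].
Qed.

Lemma Ck_on_sum k U (I : Type) (r : seq I) (F : I -> 'rV[R]_m -> 'rV[R]_n) :
  open U -> (forall i, Ck_on k U (F i)) ->
  Ck_on k U (fun x => \sum_(i <- r) F i x).
Proof.
move=> oU H; elim: r => [|i r IH].
  by under eq_fun do rewrite big_nil; exact: smooth_on_cst.
by under eq_fun do rewrite big_cons; exact: Ck_onD.
Qed.

End Ck_basics.

Lemma differentiable_coordinate {R : realType} {V : normedModType R} {n}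
    (f : V -> 'rV[R]_n) i x :
  differentiable f x -> differentiable (fun y => f y 0 i) x.
Proof.
move=> df; apply: (@differentiable_comp _ _ _ _ f (fun M : 'rV[R]_n => M 0 i)) => //.
exact: differentiable_coord.
Qed.

Lemma derive_coordinate {R : realType} {V : normedModType R} {n}
    (f : V -> 'rV[R]_n) i x v :
  differentiable f x -> 'D_v (fun y => f y 0 i) x = 'D_v f x 0 i.
Proof. by move=> df; rewrite derive_mx ?mxE//; exact: diff_derivable. Qed.


Lemma differentiable_coords {R : realType} {V : normedModType R} {n}
    (f : V -> 'rV[R]_n) x :
  (forall i, differentiable (fun y => f y 0 i) x) -> differentiable f x.
Proof.
move=> H; rewrite (_ : f = \sum_i (fun y => f y 0 i *: delta_mx 0 i)).
  by apply: differentiable_sum => i; exact: differentiableZl.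
apply/funext => y; rewrite fct_sumE; exact: row_sum_delta.
Qed.

Lemma diff_scale {R : realType} {V : normedModType R} {n}
    (s : V -> R) (g : V -> 'rV[R]_n) x v :
  differentiable s x -> differentiable g x ->
  differentiable (fun y => s y *: g y) x /\
  'D_v (fun y => s y *: g y) x = 'D_v s x *: g x + s x *: 'D_v g x.
Proof.
move=> ds dg.
have E i : (fun y => (s y *: g y) 0 i) = (s * (fun y => g y 0 i)).
  by apply/funext => y; rewrite mxE.
have D : differentiable (fun y => s y *: g y) x.
  apply: differentiable_coords => i; rewrite E.
  by apply: differentiableM => //; exact: differentiable_coordinate.
split=> //; apply/rowP => i; rewrite -derive_coordinate// E deriveM//.
- by rewrite !mxE derive_coordinate// addrC; congr (_ + _); rewrite mulrC.
- exact: diff_derivable.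
- by apply: diff_derivable; exact: differentiable_coordinate.
Qed.

Lemma derive_comp {R : realType} {V W X : normedModType R}
    (f : V -> W) (g : W -> X) x v :
  differentiable f x -> differentiable g (f x) ->
  'D_v (g \o f) x = 'D_('D_v f x) g (f x).
Proof.
move=> df dg; rewrite !deriveE//; last exact: differentiable_comp.
by rewrite diff_comp.
Qed.

Lemma derive_row {R : realType} {n} {W : normedModType R}
    (g : 'rV[R]_n -> W) x v : differentiable g x ->
  'D_v g x = \sum_i v 0 i *: 'D_(delta_mx 0 i) g x.
Proof.
move=> dg; rewrite deriveE// {1}(row_sum_delta v) linear_sum.
by apply: eq_bigr => i _; rewrite linearZ deriveE.
Qed.

Section Ck_products.
Context {R : realType} {m : nat}.
Context (U : set 'rV[R]_m) (oU : open U).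

Lemma Ck_on_coordinate k n (f : 'rV[R]_m -> 'rV[R]_n) i :
  Ck_on k U f -> Ck_on k U (fun x => const_mx (f x 0 i) : 'rV[R]_1).
Proof.
elim: k f => [|k IH] f /=.
  move=> H x Ux.
  apply: (@continuous_comp _ _ _ (fun y => f y 0 i)
    (fun r => const_mx r : 'rV[R]_1)).
    apply: (@continuous_comp _ _ _ f (fun M : 'rV[R]_n => M 0 i)).
      exact: H.
    exact: coord_continuous.
  exact: continuous_const_mx.
case=> H K.
have E x : U x -> forall j,
    differentiable (fun x => (const_mx (f x 0 i) : 'rV[R]_1) 0 j) x.
  move=> Ux j; rewrite (_ : (fun _ => _) = (fun y => f y 0 i)).
    by apply: differentiable_coordinate; exact: H.
  by apply/funext => y; rewrite mxE.
split=> [x Ux|v]; first by apply: differentiable_coords; exact: E.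
apply: eq_Ck_on (IH _ (K v)) => // x Ux; apply/rowP => j.
rewrite -[RHS]derive_coordinate; last by apply: differentiable_coords; exact: E.
rewrite mxE -derive_coordinate; last exact: H.
by congr ('D_v _ x); apply/funext => y; rewrite mxE.
Qed.

Lemma Ck_on_scale k n (s : 'rV[R]_m -> 'rV[R]_1) (g : 'rV[R]_m -> 'rV[R]_n) :
  Ck_on k U s -> Ck_on k U g -> Ck_on k U (fun x => s x 0 0 *: g x).
Proof.
elim: k s g => [|k IH] s g.
  move=> Hs Hg x Ux.
  apply: (@continuousZ _ _ _ (fun y => s y 0 0) g); last exact: Hg.
  apply: (@continuous_comp _ _ _ s (fun M : 'rV[R]_1 => M 0 0)).
    exact: Hs.
  exact: coord_continuous.
move=> Ks Kg; have [[Hs Ks'] [Hg Kg']] := (Ks, Kg).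
have D x v : U x -> _ := fun Ux =>
  diff_scale v (differentiable_coordinate 0 (Hs x Ux)) (Hg x Ux).
split=> [x Ux|v]; first exact: (D x 0 Ux).1.
have K1 := IH _ _ (Ks' v) (Ck_onW Kg); have K2 := IH _ _ (Ck_onW Ks) (Kg' v).
apply: eq_Ck_on (Ck_onD oU K1 K2) => // x Ux.
by rewrite (D x v Ux).2 derive_coordinate//; exact: Hs.
Qed.

Lemma Ck_on_coords k n (f : 'rV[R]_m -> 'rV[R]_n) :
  (forall i, Ck_on k U (fun x => const_mx (f x 0 i) : 'rV[R]_1)) -> Ck_on k U f.
Proof.
move=> H.
have : Ck_on k U (fun x =>
    \sum_i (const_mx (f x 0 i) : 'rV[R]_1) 0 0 *: delta_mx 0 i : 'rV[R]_n).
  by apply: Ck_on_sum => // i; apply: Ck_on_scale => //; exact: smooth_on_cst.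
apply: eq_Ck_on => // x Ux; rewrite [RHS]row_sum_delta.
by apply: eq_bigr => i _; rewrite mxE.
Qed.

(** By the chain rule a directional derivative of [g \o f] is the sum of the
partial derivatives of [g] along [f], with the coordinates of the derivative of
[f] as coefficients; each summand is a product of C^k maps by induction. *)
Lemma Ck_on_comp k n p (V : set 'rV[R]_n) (f : 'rV[R]_m -> 'rV[R]_n)
    (g : 'rV[R]_n -> 'rV[R]_p) :
  (forall x, U x -> V (f x)) -> Ck_on k U f -> Ck_on k V g ->
  Ck_on k U (g \o f).
Proof.
move=> UV; elim: k p g => [|k IH] p g.
  by move=> Hf Hg x Ux; apply: continuous_comp; [exact: Hf|exact: Hg (UV x Ux)].
move=> Kf [Hg Kg]; have [Hf Kf'] := Kf; split=> [x Ux|v].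
  by apply: differentiable_comp; [exact: Hf|exact: Hg (UV x Ux)].
have : Ck_on k U (fun x => \sum_i
   (const_mx ('D_v f x 0 i) : 'rV[R]_1) 0 0 *: ('D_(delta_mx 0 i) g \o f) x).
  apply: Ck_on_sum => // i; apply: Ck_on_scale.
    exact: Ck_on_coordinate (Kf' v).
  exact: IH (Ck_onW Kf) (Kg _).
apply: eq_Ck_on => // x Ux.
rewrite [RHS]derive_comp; [|exact: Hf|exact: Hg (UV x Ux)].
rewrite [RHS]derive_row; last exact: Hg (UV x Ux).
by apply: eq_bigr => i _; rewrite mxE.
Qed.

Lemma Ck_on_mulmx k n p (f : 'rV[R]_m -> 'rV[R]_n) (A : 'M[R]_(n, p)) :
  Ck_on k U f -> Ck_on k U (fun x => f x *m A).
Proof.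
move=> Kf.
have : Ck_on k U (fun x => \sum_i (const_mx (f x 0 i) : 'rV[R]_1) 0 0 *: row i A).
  apply: Ck_on_sum => // i; apply: Ck_on_scale; first exact: Ck_on_coordinate.
  exact: smooth_on_cst.
apply: eq_Ck_on => // x Ux; rewrite mulmx_sum_row.
by apply: eq_bigr => i _; rewrite mxE.
Qed.

(** Real-valued functions are regarded as row vectors of length one, so that the
results on [Ck_on] apply to them. *)
Definition Ck_fun k (s : 'rV[R]_m -> R) :=
  Ck_on k U (fun x => const_mx (s x) : 'rV[R]_1).

Lemma eq_Ck_fun k s t : s =1 t -> Ck_fun k s -> Ck_fun k t.
Proof. by move=> /funext ->. Qed.

Lemma Ck_fun_cst k a : Ck_fun k (fun=> a).
Proof. exact: smooth_on_cst. Qed.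

Lemma Ck_funM k s t : Ck_fun k s -> Ck_fun k t -> Ck_fun k (fun x => s x * t x).
Proof.
move=> Ks Kt; apply: eq_Ck_on (Ck_on_scale Ks Kt) => // x _.
by apply/rowP => i; rewrite !mxE.
Qed.

Lemma Ck_fun_sum k (I : Type) (r : seq I) (F : I -> 'rV[R]_m -> R) :
  (forall i, Ck_fun k (F i)) -> Ck_fun k (fun x => \sum_(i <- r) F i x).
Proof.
move=> H; apply: eq_Ck_on (Ck_on_sum r oU H) => // x _.
by apply/rowP => j; rewrite mxE summxE; apply: eq_bigr => i _; rewrite mxE.
Qed.

Lemma Ck_fun_prod k (I : Type) (r : seq I) (F : I -> 'rV[R]_m -> R) :
  (forall i, Ck_fun k (F i)) -> Ck_fun k (fun x => \prod_(i <- r) F i x).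
Proof.
move=> H; elim: r => [|i r IH].
  by apply: eq_Ck_fun (Ck_fun_cst k 1) => x; rewrite big_nil.
by apply: eq_Ck_fun (Ck_funM (H i) IH) => x; rewrite big_cons.
Qed.

Lemma Ck_fun_det k n (A : 'rV[R]_m -> 'M[R]_n) :
  (forall i j, Ck_fun k (fun x => A x i j)) -> Ck_fun k (fun x => \det (A x)).
Proof.
move=> H; apply: Ck_fun_sum => s; apply: Ck_funM; first exact: Ck_fun_cst.
by apply: Ck_fun_prod => i; exact: H.
Qed.

(** Induction on [k], since the derivative of [1 / s] is [- (1 / s)^2 s']. *)
Lemma Ck_funV k s : (forall x, U x -> s x != 0) ->
  Ck_fun k s -> Ck_fun k (fun x => (s x)^-1).
Proof.
move=> s0; elim: k => [|k IH] Ks.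
  have cs x : U x -> {for x, continuous s}.
    move=> Ux; rewrite (_ : s = fun x => (const_mx (s x) : 'rV[R]_1) 0 0).
      apply: (@continuous_comp _ _ _ (fun x => const_mx (s x) : 'rV[R]_1)
        (fun M : 'rV[R]_1 => M 0 0)).
        exact: Ks.
      exact: coord_continuous.
    by apply/funext => y; rewrite mxE.
  move=> x Ux; apply: (@continuous_comp _ _ _ (fun y => (s y)^-1)
    (fun r => const_mx r : 'rV[R]_1)).
    by apply: continuousV; [exact: s0|exact: cs].
  exact: continuous_const_mx.
have [Hs Ks'] := Ks.
have ds x : U x -> differentiable s x.
  move=> Ux; rewrite (_ : s = fun x => (const_mx (s x) : 'rV[R]_1) 0 0).
    by apply: differentiable_coordinate; exact: Hs.
  by apply/funext => y; rewrite mxE.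
have dc x : U x -> differentiable (fun x => const_mx (s x)^-1 : 'rV[R]_1) x.
  move=> Ux; apply: differentiable_coords => i.
  rewrite (_ : (fun _ => _) = (fun y => (s y)^-1)).
    by apply: differentiableV; [exact: ds|exact: s0].
  by apply/funext => y; rewrite mxE.
split; first exact: dc.
move=> v; have IHs := IH (Ck_onW Ks).
have : Ck_fun k (fun x => - 1 * ((s x)^-1 * (s x)^-1) * 'D_v s x).
  apply: Ck_funM.
    by apply: Ck_funM; [exact: Ck_fun_cst|exact: Ck_funM].
  apply: eq_Ck_on (Ks' v) => // x Ux; apply/rowP => i.
  rewrite mxE -derive_coordinate; last exact: Hs.
  by congr ('D_v _ x); apply/funext => y; rewrite mxE.
apply: eq_Ck_on => // x Ux; apply/rowP => i; rewrite mxE.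
rewrite -derive_coordinate; last exact: dc.
rewrite (_ : (fun _ => _) = (fun y => (s y)^-1)); last first.
  by apply/funext => y; rewrite mxE.
rewrite deriveV; [|exact: s0|exact: diff_derivable (ds x Ux)].
by rewrite mulN1r -expr2 exprVn.
Qed.

(** Cramer's rule: the entries of the inverse are quotients of polynomials in
the entries. *)
Lemma Ck_fun_invmx k n (A : 'rV[R]_m -> 'M[R]_n) i j :
  (forall x, U x -> A x \in unitmx) ->
  (forall i j, Ck_fun k (fun x => A x i j)) -> Ck_fun k (fun x => invmx (A x) i j).
Proof.
move=> uA KA.
have : Ck_fun k (fun x => (\det (A x))^-1 * cofactor (A x) j i).
  apply: Ck_funM.
    apply: Ck_funV; last exact: Ck_fun_det.
    by move=> x /uA; rewrite unitmxE unitfE.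
  apply: Ck_funM; first exact: Ck_fun_cst.
  apply: Ck_fun_det => a b; apply: eq_Ck_fun (KA (lift j a) (lift i b)) => x.
  by rewrite !mxE.
by apply: eq_Ck_on => // x Ux; rewrite /invmx uA// !mxE.
Qed.

End Ck_products.

(** * The inverse function theorem and submersions in coordinates *)

Lemma mulmxr_continuous {R : realType} {n p : nat} (A : 'M[R]_(n, p)) :
  continuous (mulmxr A : {linear 'rV[R]_n -> 'rV[R]_p}).
Proof.
by move=> u; exact: (@Ck_on_mulmx _ _ _ openT 0 _ _ id A (smooth_on_id setT 0)).
Qed.

Lemma mulmx_bounded {R : realType} {n p : nat} (A : 'M[R]_(n, p)) :
  exists2 C : R, 0 < C & forall u : 'rV[R]_n, `|u *m A| <= C * `|u|.
Proof. exact: (linear_lipschitz (@mulmxr_continuous _ _ _ A)). Qed.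

Lemma mx_norm_le {R : realType} {n : nat} (u : 'rV[R]_n) (C : R) :
  0 <= C -> (forall i, `|u 0 i| <= C) -> `|u| <= C.
Proof.
move=> C0 H; rewrite /Num.Def.normr/= mx_normrE; apply: bigmax_le => // -[i j] _ /=.
by rewrite ord1.
Qed.

Lemma le_mx_norm {R : realType} {n : nat} (u : 'rV[R]_n) i : `|u 0 i| <= `|u|.
Proof.
rewrite [leRHS]/Num.Def.normr/= mx_normrE.
by apply: (le_trans _ (le_bigmax _ _ (0, i))).
Qed.

(** Each coordinate of [f] along the segment is a function of one variable, to
which the mean value theorem applies; the maximum norm puts the coordinates
together again. *)
Lemma mean_value_le {R : realType} {n m : nat} (f : 'rV[R]_n -> 'rV[R]_m)
    (a b : 'rV[R]_n) (C : R) :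
  (forall t, 0 <= t <= 1 ->
     differentiable f (t *: (b - a) + a) /\
     `|'D_(b - a) f (t *: (b - a) + a)| <= C) ->
  `|f b - f a| <= C.
Proof.
move=> H; set u := b - a.
pose l := ( *:%R^~ u) \+ cst a : R -> 'rV[R]_n.
have dl (t : R) : is_diff t l (( *:%R^~ u) \+ 0) by exact: is_diffD.
have Dl (t : R) : 'D_1 l t = u.
  by rewrite deriveE// diff_val /= addr0 scale1r.
have C0 : 0 <= C.
  by apply: le_trans (H 0 _).2; rewrite ?lexx ?ler01.
apply: mx_norm_le => // i.
have dli (t : R) : 0 <= t <= 1 ->
    is_derive t 1 (fun t => f (l t) 0 i) ('D_u f (l t) 0 i).
  move=> /H[df _]; have dfl : differentiable (f \o l) t.
    by apply: differentiable_comp.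
  apply: DeriveDef.
    by apply: diff_derivable; exact: differentiable_coordinate dfl.
  have dlt : differentiable l t by exact: (@ex_diff _ _ _ _ _ _ _ (dl t)).
  have dft : differentiable f (l t) := df.
  by rewrite (derive_coordinate _ _ dfl) (derive_comp (1 : R) dlt dft) Dl.
have [| |c] := @MVT_segment R (fun t => f (l t) 0 i)
  (fun t => 'D_u f (l t) 0 i) 0 1 ler01.
- by move=> x; rewrite in_itv /= => /andP[x0 x1]; apply: dli; rewrite !ltW.
- apply: derivable_within_continuous => x; rewrite in_itv /= => /dli dx.
  exact: ex_derive.
rewrite in_itv /= => c01.
rewrite subr0 mulr1 /l /= scale1r scale0r add0r subrK !mxE => ->.
by apply: le_trans (H c c01).2; exact: le_mx_norm.
Qed.

Section inverse_function.
Context {R : realType} {n : nat}.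
Context (U : set 'rV[R]_n) (Phi : 'rV[R]_n -> 'rV[R]_n) (a : 'rV[R]_n).
Context (oU : open U) (Ua : U a) (sPhi : smooth_on U Phi).
Context (dPhi : forall v, 'D_v Phi a = v).

Let dfPhi z : U z -> differentiable Phi z := (sPhi 1%N).1 z.

(** The partial derivatives are continuous, so near [a] each of them is within
[1 / (2 (n + 1))] of its value at [a]; the sum over the [n] coordinates turns
this into the factor [1 / 2]. *)
Lemma derive_near_id : \forall z \near a, U z /\
  forall u, `|'D_u Phi z - u| <= 2^-1 * `|u|.
Proof.
(* [n + 1] rather than [n], so as to include dimension 0 *)
pose e : R := (2 * n.+1%:R)^-1.
have e0 : 0 < e by rewrite invr_gt0 mulr_gt0// ltr0n.
have H j : \forall z \near a, `|'D_(delta_mx 0 j) Phi z - delta_mx 0 j| <= e.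
  have c : {for a, continuous ('D_(delta_mx 0 j) Phi)} by exact: (sPhi 1%N).2.
  move/cvgrPdist_le : c => /(_ e e0); apply: filterS => z.
  by rewrite dPhi distrC.
have nU : \forall z \near a, U z by exact: open_nbhs_nbhs.
have Hall : \forall z \near a,
    forall j, `|'D_(delta_mx 0 j) Phi z - delta_mx 0 j| <= e.
  exact: (@filter_forall _ 'I_n
    (fun j z => `|'D_(delta_mx 0 j) Phi z - delta_mx 0 j| <= e)
    _ (nbhs_filter a) H).
move: nU Hall; apply: filterS2 => z Uz Hz; split=> // u.
rewrite derive_row; last exact: dfPhi.
rewrite {2}(row_sum_delta u) -sumrB (le_trans (ler_norm_sum _ _ _))//.
apply: (@le_trans _ _ (\sum_(i < n) `|u| * e)).
  apply: ler_sum => i _; rewrite -scalerBr normrZ.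
  by apply: ler_pM => //; exact: le_mx_norm.
rewrite sumr_const card_ord -[leLHS]mulr_natr -mulrA mulrC ler_wpM2r//.
rewrite /e invfM -mulrA ler_piMr ?invr_ge0//.
by rewrite mulrC ler_pdivrMr ?ltr0n// mul1r ler_nat.
Qed.

Lemma derive_near_id_ball : exists2 r : R, 0 < r & forall z, `|z - a| <= r -> U z /\
  forall u, `|'D_u Phi z - u| <= 2^-1 * `|u|.
Proof.
have [r /= r0 H] := (nbhs_ballP _ _).1 derive_near_id.
exists (r / 2); first by rewrite divr_gt0.
move=> z zr; apply: H; rewrite -ball_normE /= distrC.
by rewrite (le_lt_trans zr)// ltr_pdivrMr// ltr_pMr// ltr1n.
Qed.

Lemma segment_ball (x y : 'rV[R]_n) (r t : R) : 0 <= t <= 1 ->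
  `|x - a| <= r -> `|y - a| <= r -> `|t *: (y - x) + x - a| <= r.
Proof.
move=> /andP[t0 t1] xr yr.
rewrite (_ : _ - a = t *: (y - a) + (1 - t) *: (x - a)); last first.
  apply/rowP => i; rewrite !mxE; lra.
rewrite (le_trans (ler_normD _ _))// !normrZ !ger0_norm ?subr_ge0//.
have : t * `|y - a| <= t * r by rewrite ler_wpM2l.
have : (1 - t) * `|x - a| <= (1 - t) * r by rewrite ler_wpM2l// subr_ge0.
lra.
Qed.

Section ball.
Context (r : R) (r0 : 0 < r).
Context (good : forall z, `|z - a| <= r -> U z /\
  forall u, `|'D_u Phi z - u| <= 2^-1 * `|u|).

(** [Phi - id] is a contraction on the ball, which is convex. *)
Lemma deviation_lipschitz x y : `|x - a| <= r -> `|y - a| <= r ->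
  `|(Phi y - y) - (Phi x - x)| <= 2^-1 * `|y - x|.
Proof.
move=> xr yr; apply: (@mean_value_le _ _ _ (fun z => Phi z - z)) => t t01.
have [Uz Hz] := good (segment_ball t01 xr yr).
split; first by apply: differentiableB => //; exact: dfPhi.
rewrite deriveB//; last exact: diff_derivable (dfPhi Uz).
by rewrite derive_id; exact: Hz.
Qed.

Lemma ball_expansion x y : `|x - a| <= r -> `|y - a| <= r ->
  `|y - x| <= 2 * `|Phi y - Phi x|.
Proof.
move=> xr yr; have := deviation_lipschitz xr yr.
have : `|y - x| <= `|Phi y - Phi x| + `|(Phi y - y) - (Phi x - x)|.
  rewrite (le_trans _ (ler_normB _ _))// le_eqVlt; apply/orP; left; apply/eqP.
  congr `| _ |; apply/rowP => i; rewrite !mxE; lra.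
lra.
Qed.

(** Solutions of [Phi z = y] are the fixed points of [z |-> y - (Phi z - z)],
a contraction that maps the ball to itself when [y] is within [r / 2] of
[Phi a]. *)
Lemma local_preimage y : `|y - Phi a| <= r / 2 ->
  exists2 z, `|z - a| <= r & Phi z = y.
Proof.
move=> yr.
pose B := [set z : 'rV[R]_n | `|z - a| <= r].
pose T z := y - (Phi z - z).
have aB : `|a - a| <= r by rewrite subrr normr0 ltW.
have BT : {homo T : z / B z >-> B z}.
  move=> z Bz; rewrite /B /T /=.
  have := deviation_lipschitz aB Bz => D.
  have -> : y - (Phi z - z) - a = (y - Phi a) - ((Phi z - z) - (Phi a - a)).
    apply/rowP => i; rewrite !mxE; lra.
  rewrite (le_trans (ler_normB _ _))//.
  move: (Bz : `|z - a| <= r) => Bz'. lra.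
have cT : is_contraction (mkfun_fun BT).
  have h0 : 0 <= 2^-1 :> R by lra.
  exists (NngNum h0); split => /=; first lra.
  move=> [x z] [/= Bx Bz].
  have -> : mkfun_fun BT x - mkfun_fun BT z = (Phi z - z) - (Phi x - x).
    apply/rowP => i; rewrite !mxE; lra.
  by rewrite [`|x - z|]distrC; exact: deviation_lipschitz.
have clB : closed B.
  have c (z : 'rV[R]_n) : {for z, continuous (fun z : 'rV[R]_n => `|z - a|)}.
    have cB : {for z, continuous ((id : 'rV[R]_n -> 'rV[R]_n) \- cst a)}.
      by apply: continuousB; [exact: cvg_id|exact: cst_continuous].
    exact: cvg_norm cB.
  rewrite (_ : B = (fun z => `|z - a|) @^-1` [set t | t <= r])//.
  apply: closed_comp; last exact: closed_le.
  by move=> z _; exact: c.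
pose X : completeNormedModType R :=
  HB.pack 'rV[R]_n (Uniform_isComplete.Build 'rV[R]_n cauchy_cvg).
have [z Bz zT] := @banach_fixed_point R X B (mkfun_fun BT) cT clB (ex_intro _ a aB).
exists z => //; move: zT; rewrite /= /mkfun_fun /mkfun /T => zT.
apply/eqP; rewrite -subr_eq0; apply/eqP.
have : z - (y - (Phi z - z)) = 0 by rewrite -zT subrr.
by move=> <-; apply/rowP => i; rewrite !mxE; lra.
Qed.

Let W : set 'rV[R]_n := ball (Phi a) (r / 2).

Lemma preimage_on_ball : exists Psi : 'rV[R]_n -> 'rV[R]_n,
  Psi (Phi a) = a /\ forall y, W y -> `|Psi y - a| <= r /\ Phi (Psi y) = y.
Proof.
have H y : exists z, W y -> `|z - a| <= r /\ Phi z = y.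
  have [Wy|nW] := pselect (W y); last by exists a => /nW.
  have [|z za zy] := @local_preimage y; last by exists z.
  by move: Wy; rewrite /W -ball_normE /= distrC => /ltW.
have [Psi PsiP] := choice H; exists Psi; split => //.
have Wa : W (Phi a) by apply: ballxx; rewrite divr_gt0.
have [h1 h2] := PsiP _ Wa; apply/eqP; rewrite -subr_eq0 -normr_le0.
have aB : `|a - a| <= r by rewrite subrr normr0 ltW.
by rewrite (le_trans (ball_expansion aB h1))// h2 subrr normr0 mulr0.
Qed.

(** A vector killed by the Jacobian is displaced by its full length, whereas the
differential moves every vector by at most half of it. *)
Lemma jacobian_unit z : `|z - a| <= r -> 'J Phi z \in unitmx.
Proof.
move=> zr; have [Uz Hz] := good zr; rewrite -row_free_unit.
apply: inj_row_free => v vJ; have := Hz v.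
rewrite deriveEjacobian; last exact: dfPhi.
rewrite vJ sub0r normrN => h; apply/eqP; rewrite -normr_le0.
have := normr_ge0 v. lra.
Qed.

Context (Psi : 'rV[R]_n -> 'rV[R]_n).
Context (PsiP : forall y, W y -> `|Psi y - a| <= r /\ Phi (Psi y) = y).

Lemma preimage_lipschitz x y : W x -> W y -> `|Psi y - Psi x| <= 2 * `|y - x|.
Proof.
move=> /PsiP[x1 x2] /PsiP[y1 y2].
by have := ball_expansion x1 y1; rewrite x2 y2.
Qed.

Let nearW y : W y -> \forall h \near (0 : 'rV[R]_n), W (h + y).
Proof.
move=> Wy; apply: near_translate.
by apply: open_nbhs_nbhs; split=> //; exact: ball_open.
Qed.

(** With [d] the increment of [Psi] for the increment [h], differentiability of
[Phi] gives [h = d J + o(d)]; as [d = O(h)] by the Lipschitz bound, multiplying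
by the inverse of [J] gives [d = h J^-1 + o(h)]. *)
Lemma preimage_differentiable y : W y ->
  differentiable Psi y /\ forall v, 'D_v Psi y = v *m invmx ('J Phi (Psi y)).
Proof.
move=> Wy; have [yr Py] := PsiP Wy.
have [Uz Hz] := good yr; have uJ := jacobian_unit yr.
set J := 'J Phi (Psi y) in uJ *; set A := invmx J.
have cA := @mulmxr_continuous _ _ _ A.
have [C C0 CA] := mulmx_bounded A.
have [|d dE] := @differentiable_eps _ _ _ Psi (mulmxr A) y cA; last first.
  by split=> // v; rewrite deriveE// dE.
move=> e e0; have e'0 : 0 < e / (2 * C) by rewrite divr_gt0// mulr_gt0.
have /nbhs_ballP[s /= s0 H] := diff_eps (dfPhi Uz) e'0.
have : \forall h \near (0 : 'rV[R]_n), `|h| < s / 2.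
  by apply: nbhs0_lt; rewrite divr_gt0.
move: (nearW Wy); apply: filterS2 => h Wh hs.
pose d := Psi (h + y) - Psi y.
have dh : `|d| <= 2 * `|h| by have := preimage_lipschitz Wy Wh; rewrite addrK.
have [_ Ph] := PsiP Wh.
have := H d; rewrite -ball_normE /= sub0r normrN => /(_ _).
rewrite [d + _]addrNK Ph Py => /(_ _) Hd.
have {}Hd : `|h - d *m J| <= e / (2 * C) * `|d|.
  rewrite -deriveE in Hd; last exact: dfPhi.
  rewrite deriveEjacobian in Hd; last exact: dfPhi.
  have -> : h - d *m J = h + y - (y + d *m J) by rewrite opprD addrA addrK.
  by apply: Hd; rewrite (le_lt_trans dh)// mulrC -ltr_pdivlMr.
have -> : Psi (h + y) - (Psi y + h *m A) = - ((h - d *m J) *m A).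
  by rewrite mulmxBl -mulmxA mulmxV// mulmx1 opprB opprD addrA.
rewrite normrN (le_trans (CA _))//.
rewrite (le_trans (ler_wpM2l (ltW C0) Hd))//.
rewrite (le_trans (ler_wpM2l (ltW C0) (ler_wpM2l (ltW e'0) dh)))//.
rewrite (_ : C * _ = e * `|h|)//; field; exact: lt0r_neq0.
Qed.

(** Bootstrapping: the derivative of [Psi] at [y] is the inverse of the Jacobian
of [Phi] at [Psi y], which is C^k as soon as [Psi] is. *)
Lemma preimage_smooth : smooth_on W Psi.
Proof.
have oW : open W by exact: ball_open.
elim=> [|k IH].
  by move=> y /preimage_differentiable[/differentiable_continuous].
split=> [y /preimage_differentiable[]//|v].
have : Ck_on k W (fun y => v *m invmx ('J Phi (Psi y))).
  apply: Ck_on_coords => // j.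
  have : Ck_fun W k (fun y => \sum_i v 0 i * invmx ('J Phi (Psi y)) i j).
    apply: Ck_fun_sum => // i; apply: Ck_funM => //; first exact: Ck_fun_cst.
    apply: Ck_fun_invmx => // [y /PsiP[yr _]|i' j']; first exact: jacobian_unit.
    have : Ck_on k W ('D_(delta_mx 0 i') Phi \o Psi).
      apply: (Ck_on_comp oW _ IH ((sPhi k.+1).2 _)) => y /PsiP[yr _].
      exact: (good yr).1.
    move=> /(Ck_on_coordinate oW j'); apply: eq_Ck_on => // y /PsiP[yr _] /=.
    rewrite deriveEjacobian; last exact: dfPhi (good yr).1.
    by rewrite -rowE mxE.
  by apply: eq_Ck_on => // y Wy; rewrite mxE.
by apply: eq_Ck_on => // y /preimage_differentiable[_ ->].
Qed.

End ball.
End inverse_function.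

(** The inverse function theorem, normalized so that the differential at the
base point is the identity; the map that straightens a submersion is of this
kind. *)
Theorem local_inverse {R : realType} {n : nat} (U : set 'rV[R]_n)
    (Phi : 'rV[R]_n -> 'rV[R]_n) (a : 'rV[R]_n) :
  open U -> U a -> smooth_on U Phi -> (forall v, 'D_v Phi a = v) ->
  exists (W : set 'rV[R]_n) (Psi : 'rV[R]_n -> 'rV[R]_n),
    [/\ open W /\ W (Phi a), Psi (Phi a) = a,
        forall y, W y -> U (Psi y) /\ Phi (Psi y) = y,
        smooth_on W Psi & forall v, 'D_v Psi (Phi a) = v].
Proof.
move=> oU Ua sPhi dPhi.
have [r r0 good] := derive_near_id_ball oU Ua sPhi dPhi.
have [Psi [Psia PsiP]] := preimage_on_ball sPhi r0 good.
have Wa : ball (Phi a) (r / 2) (Phi a) by apply: ballxx; rewrite divr_gt0.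
exists (ball (Phi a) (r / 2)), Psi; split => //.
- by split=> //; exact: ball_open.
- by move=> y /PsiP[/good[]].
- exact: (preimage_smooth sPhi good PsiP).
move=> v; have [_ ->] := preimage_differentiable sPhi good PsiP Wa.
rewrite Psia (_ : 'J Phi a = 1%:M) ?invmx1 ?mulmx1//.
apply/row_matrixP => i; rewrite !rowE mulmx1 -deriveEjacobian//.
exact: (sPhi 1%N).1.
Qed.

Lemma derive_mulmx {R : realType} {V : normedModType R} {n p : nat}
    (f : V -> 'rV[R]_n) (A : 'M[R]_(n, p)) x v : differentiable f x ->
  differentiable (fun y => f y *m A) x /\
  'D_v (fun y => f y *m A) x = 'D_v f x *m A.
Proof.
move=> df.
have cA := @mulmxr_continuous _ _ _ A.
have dA y := linear_differentiable y cA.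
split; first exact: (@differentiable_comp _ _ _ _ f (mulmxr A)).
rewrite (@derive_comp _ _ _ _ f (mulmxr A))// deriveE//.
by rewrite (diff_lin _ cA).
Qed.

(** In the coordinates given by [Psi] the submersion is affine, so that lifting
through it becomes linear algebra with the right inverse [L]. *)
Lemma submersion_straightening {R : realType} {n m : nat} (U : set 'rV[R]_n)
    (q : 'rV[R]_n -> 'rV[R]_m) (a : 'rV[R]_n) :
  open U -> U a -> smooth_on U q -> (forall w, exists v, 'D_v q a = w) ->
  exists (W : set 'rV[R]_n) (Psi : 'rV[R]_n -> 'rV[R]_n) (L : 'M[R]_(m, n)),
    [/\ open W /\ W 0, Psi 0 = a /\ forall v, 'D_v Psi 0 = v,
        smooth_on W Psi,
        forall y, W y -> U (Psi y) /\ q (Psi y) = q a + y *m 'J q a &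
        L *m 'J q a = 1%:M].
Proof.
move=> oU Ua sq surj.
have dq z : U z -> differentiable q z by exact: (sq 1%N).1.
have [Lf Lq] := choice surj.
pose L := \matrix_(i < m) Lf (delta_mx 0 i).
set J := 'J q a.
have LJ : L *m J = 1%:M.
  apply/row_matrixP => i; rewrite row_mul rowK -deriveEjacobian; last exact: dq.
  by rewrite Lq rowE mulmx1.
(* On the kernel directions of [J] this is [z - a]; the correction through [L]
   makes [Phi z *m J] equal to [q z - q a]. *)
pose Phi z := (z + - a) + ((q z + - q a) + (z + - a) *m - J) *m L.
have sC p (c : 'rV[R]_p) : smooth_on U (fun=> c) by exact: smooth_on_cst.
have sB : smooth_on U (fun z => z + - a).
  by move=> k; apply: Ck_onD => //; [exact: smooth_on_id|exact: sC].
have sPhi : smooth_on U Phi.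
  move=> k; apply: Ck_onD => //.
  apply: Ck_on_mulmx => //; apply: Ck_onD => //.
    by apply: Ck_onD => //; exact: sC.
  by apply: Ck_on_mulmx => //; exact: sB.
have dPhi v : 'D_v Phi a = v.
  have d1 := (sB 1%N).1 a Ua.
  have D1 : 'D_v (fun z => z + - a) a = v.
    by rewrite deriveD// derive_id derive_cst addr0.
  have [d2 D2] := derive_mulmx (- J) v d1.
  have d3 : differentiable (fun z => q z + - q a) a.
    by apply: differentiableD; [exact: dq|exact: differentiable_cst].
  have D3 : 'D_v (fun z => q z + - q a) a = 'D_v q a.
    by rewrite deriveD ?derive_cst ?addr0//; exact: diff_derivable (dq a Ua).
  have d4 : differentiable (fun z => q z + - q a + (z + - a) *m - J) a.
    exact: differentiableD.
  have [d5 D5] := derive_mulmx L v d4.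
  rewrite deriveD; [|exact: diff_derivable|exact: diff_derivable].
  rewrite D1 D5 deriveD; [|exact: diff_derivable|exact: diff_derivable].
  rewrite D2 D1 D3 deriveEjacobian; last exact: dq.
  by rewrite mulmxN subrr mul0mx addr0.
have Phia : Phi a = 0 by rewrite /Phi !subrr mul0mx addr0 mul0mx addr0.
have [W [Psi [[oW Wa] Psia PsiP sPsi dPsi]]] := local_inverse oU Ua sPhi dPhi.
rewrite Phia in Wa Psia dPsi.
exists W, Psi, L; split=> // y Wy; have [Uy Py] := PsiP y Wy; split=> //.
have : (Phi (Psi y)) *m J = y *m J by rewrite Py.
rewrite /Phi mulmxDl -mulmxA LJ mulmx1 mulmxN.
rewrite [_ + - (_ *m J)]addrC addrA subrr add0r.
by move=> <-; rewrite addrC subrK.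
Qed.

(** * Smooth maps and differentials on manifolds *)

Section charts.
Context {R : realType}.

Lemma chart_img_preimage (T : topologicalType) n (c : chart R T n) (O : set T) :
  c @` (chart_dom c `&` O) = (c @` chart_dom c) `&` (chart_inv c @^-1` O).
Proof.
apply/seteqP; split=> [y [x [cx Ox] <-]|y [[x cx <-]]].
  by split; [exists x|rewrite /= chart_mapK].
by rewrite /= chart_mapK// => Ox; exists x.
Qed.

Lemma chart_img_openI (T : topologicalType) n (c : chart R T n) (O : set T) :
  open O -> open (c @` (chart_dom c `&` O)).
Proof.
move=> oO; rewrite chart_img_preimage openE => y [cy Oy].
have ny : nbhs y (c @` chart_dom c).
  by apply: open_nbhs_nbhs; split=> //; exact: chart_img_open.
apply: filterI => //.
by apply: (chart_inv_continuous cy); exact: open_nbhs_nbhs.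
Qed.

Lemma chart_dom_openI (T : topologicalType) n (c : chart R T n) (O : set 'rV[R]_n) :
  open O -> open (chart_dom c `&` (c @^-1` O)).
Proof.
move=> oO; rewrite openE => y [cy Oy].
apply: filterI; first by apply: open_nbhs_nbhs; split=> //; exact: chart_dom_open.
by apply: (chart_map_continuous cy); exact: open_nbhs_nbhs.
Qed.

Lemma smooth_domain_open (M N : manifold R) (F : M -> N) (c : chart R M (dim M))
    (d : chart R N (dim N)) : continuous F ->
  open (c @` (chart_dom c `&` F @^-1` chart_dom d)).
Proof.
move=> cF; apply: chart_img_openI; apply: open_comp (chart_dom_open d).
by move=> x _; exact: cF.
Qed.

(** Smoothness in all pairs of charts follows from smoothness in one pair around
each point, because the changes of charts are smooth. *)
Lemma smooth_local (M N : manifold R) (F : M -> N) : continuous F ->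
  (forall x, exists (c : chart R M (dim M)) (d : chart R N (dim N)) (U : set _),
    [/\ atlas c /\ atlas d, chart_dom c x /\ chart_dom d (F x),
        open U /\ U (c x) & smooth_on U (d \o F \o chart_inv c)]) ->
  smooth F.
Proof.
move=> cF H; split=> // c' d' ac' ad' k.
apply: Ck_on_local => _ [x [c'x d'x] <-].
have [c [d [U [[ac ad] [cx dx] [oU Ux] sU]]]] := H x.
pose O := (chart_dom c `&` c @^-1` U) `&` (F @^-1` (chart_dom d' `&` chart_dom d)).
have oO : open O.
  apply: openI; first exact: chart_dom_openI.
  apply: open_comp => [y _|]; first exact: cF.
  by apply: openI; exact: chart_dom_open.
have oV : open (c' @` (chart_dom c' `&` O)) by exact: chart_img_openI.
exists (c' @` (chart_dom c' `&` O)); first by exists x.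
have K1 : Ck_on k (c' @` (chart_dom c' `&` O)) (c \o chart_inv c').
  apply: Ck_on_sub (atlas_compatible ac' ac k) => _ [y [c'y [[cy _] _]] <-].
  by exists y.
have K2 : Ck_on k (c' @` (chart_dom c' `&` O))
    ((d \o F \o chart_inv c) \o (c \o chart_inv c')).
  apply: (Ck_on_comp oV _ K1 (sU k)) => _ [y [c'y [[cy Uy] _]] <-].
  by rewrite /= chart_mapK.
have K3 := atlas_compatible ad ad' k.
apply: (eq_Ck_on oV _ (Ck_on_comp oV _ K2 K3)).
  move=> _ [y [c'y [[cy Uy] [d'y dy]]] <-] /=.
  by rewrite (chart_mapK c'y) (chart_mapK cy) chart_mapK.
move=> _ [y [c'y [[cy Uy] [d'y dy]]] <-] /=.
rewrite (chart_mapK c'y) (chart_mapK cy).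
by exists (F y).
Qed.

Lemma smooth_comp (M N P : manifold R) (F : M -> N) (H : N -> P) :
  smooth F -> smooth H -> smooth (H \o F).
Proof.
move=> [cF sF] [cH sH]; have cHF : continuous (H \o F).
  by move=> x; apply: continuous_comp; [exact: cF|exact: cH].
apply: smooth_local => // x.
pose c := chart_at x; pose d := chart_at (F x); pose e := chart_at (H (F x)).
have [cx dx ex] : [/\ chart_dom c x, chart_dom d (F x) & chart_dom e (H (F x))].
  by split; exact: mem_chart_at.
pose O := F @^-1` (chart_dom d `&` H @^-1` chart_dom e).
have oO : open O.
  apply: open_comp => [y _|]; first exact: cF.
  apply: openI; first exact: chart_dom_open.
  by apply: open_comp (chart_dom_open e) => y _; exact: cH.
have oU : open (c @` (chart_dom c `&` O)) by exact: chart_img_openI.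
exists c, e, (c @` (chart_dom c `&` O)); split=> //.
- by split; exact: chart_at_atlas.
- by split=> //; exists x.
move=> k; have K1 : Ck_on k (c @` (chart_dom c `&` O)) (d \o F \o chart_inv c).
  apply: Ck_on_sub (sF c d (chart_at_atlas _) (chart_at_atlas _) k).
  move=> _ [y [cy [dy ey]] <-].
  by exists y.
have K2 := sH d e (chart_at_atlas _) (chart_at_atlas _) k.
apply: (eq_Ck_on oU _ (Ck_on_comp oU _ K1 K2)).
  by move=> _ [y [cy [dy ey]] <-]; rewrite /= (chart_mapK cy) (chart_mapK dy).
move=> _ [y [cy [dy ey]] <-] /=; rewrite (chart_mapK cy).
by exists (F y).
Qed.

Lemma smooth_cst (M N : manifold R) (y : N) : smooth (fun _ : M => y).
Proof.
apply: smooth_local; first by move=> x; exact: cvg_cst.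
move=> x; exists (chart_at x), (chart_at y), setT; split=> //.
- by split; exact: chart_at_atlas.
- by split; exact: mem_chart_at.
- by split=> //; exact: openT.
- exact: smooth_on_cst.
Qed.

(** The expression of [F] in the distinguished charts, of which [differential]
takes the differential. *)
Definition local_rep (M N : manifold R) (F : M -> N) (x : M) :=
  chart_at (F x) \o F \o chart_inv (chart_at x).

Lemma near_chart (M : manifold R) (x : M) (O : set M) : open O -> O x ->
  \forall y \near chart_at x x,
    exists z, [/\ chart_dom (chart_at x) z, O z & chart_at x z = y].
Proof.
move=> oO Ox.
have : \forall y \near chart_at x x,
    (chart_at x @` (chart_dom (chart_at x) `&` O)) y.
  apply: open_nbhs_nbhs; split; first exact: chart_img_openI.
  by exists x => //; split=> //; exact: mem_chart_at.
by apply: filterS => y [z [cz Oz] <-]; exists z.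
Qed.

Lemma local_rep_differentiable (M N : manifold R) (F : M -> N) (x : M) :
  smooth F -> differentiable (local_rep F x) (chart_at x x).
Proof.
move=> [_ sF]; apply: (sF _ _ (chart_at_atlas x) (chart_at_atlas (F x)) 1%N).1.
by exists x => //; split; exact: mem_chart_at.
Qed.

Lemma local_rep_at (M N : manifold R) (F : M -> N) (x : M) :
  local_rep F x (chart_at x x) = chart_at (F x) (F x).
Proof. by rewrite /local_rep /= chart_mapK//; exact: mem_chart_at. Qed.

Lemma local_rep_comp (M N P : manifold R) (F : M -> N) (H : N -> P) x :
  continuous F ->
  \forall y \near chart_at x x,
    (local_rep H (F x) \o local_rep F x) y = local_rep (H \o F) x y.
Proof.
move=> cF; have oO : open (F @^-1` chart_dom (chart_at (F x))).
  by apply: open_comp (chart_dom_open _) => y _; exact: cF.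
have := near_chart oO (mem_chart_at (F x)).
apply: filterS => _ [z [cz dz <-]].
by rewrite /local_rep /= (chart_mapK cz) (chart_mapK dz).
Qed.

Lemma differential_derive (M N : manifold R) (F : M -> N) (x : M)
    (v : 'rV[R]_(dim M)) :
  smooth F -> differential F x v = 'D_v (local_rep F x) (chart_at x x).
Proof. by move=> sF; rewrite deriveE//; exact: local_rep_differentiable. Qed.

Lemma differential_comp (M N P : manifold R) (F : M -> N) (H : N -> P) x
    (v : 'rV[R]_(dim M)) :
  smooth F -> smooth H ->
  differential (H \o F) x v = differential H (F x) (differential F x v)
    :> 'rV[R]_(dim P).
Proof.
move=> sF sH; have nE := local_rep_comp H x sF.1.
have dF := local_rep_differentiable x sF.
have dH := local_rep_differentiable (F x) sH.
rewrite -(local_rep_at F x) in dH.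
rewrite (differential_derive _ _ (smooth_comp sF sH)) -(near_eq_derive v nE).
rewrite (differential_derive _ _ sF) (differential_derive _ _ sH).
by rewrite (derive_comp v dF dH) local_rep_at.
Qed.

(** Tangent vectors at equal points have the same coordinates, which allows
rewriting along equations such as [source (unit_at x) = x]. *)
Lemma differential_at (M N : manifold R) (F : M -> N) (x y : M)
    (v : 'rV[R]_(dim M)) :
  x = y -> differential F x v = differential F y v :> 'rV[R]_(dim N).
Proof. by move=> ->. Qed.

Lemma differentialZ (M N : manifold R) (F : M -> N) (x : M) (a : R)
    (v : 'rV[R]_(dim M)) :
  differential F x (a *: v) = a *: differential F x v :> 'rV[R]_(dim N).
Proof. exact: linearZ. Qed.

End charts.

(** * Lifting curves through submersions *)

Section curves.
Context {R : realType}.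

Lemma const1_mulmx p (B : 'M[R]_(1, p)) : const_mx 1 *m B = B.
Proof. by apply/rowP => i; rewrite mxE big_ord1 mxE mul1r. Qed.

Lemma const_mx0 : const_mx 0 = 0 :> 'rV[R]_1.
Proof. by apply/rowP => i; rewrite !mxE. Qed.

(** A smooth map of the line into [(-d, d)] with velocity [d] at 0, used to
reparametrize curves that exist only for short times. *)
Definition squash (d : R) (t : 'rV[R]_1) : 'rV[R]_1 :=
  const_mx (d * (t 0 0 * (1 + t 0 0 * t 0 0)^-1)).

Lemma squash_den (t : R) : 1 + t * t != 0.
Proof. by rewrite gt_eqF// -expr2 ltr_pwDl// sqr_ge0. Qed.

Lemma squash_smooth d : smooth_on setT (squash d).
Proof.
move=> k.
have Kx : Ck_fun [set: 'rV[R]_1] k (fun t => t 0 0).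
  exact: (Ck_on_coordinate openT 0 (smooth_on_id setT k)).
apply: (Ck_funM openT); first exact: Ck_fun_cst.
apply: (Ck_funM openT) => //.
apply: (Ck_funV openT) => [t _|]; first exact: squash_den.
have := Ck_onD openT (Ck_fun_cst setT k 1) (Ck_funM openT Kx Kx).
by apply: eq_Ck_on (openT) _ => t _; apply/rowP => i; rewrite !mxE.
Qed.

Lemma squash0 d : squash d 0 = 0.
Proof. by apply/rowP => i; rewrite !mxE mul0r mulr0. Qed.

Lemma squash_bound d t : 0 < d -> `|squash d t| < d.
Proof.
move=> d0; apply: (@le_lt_trans _ _ (d / 2)); last first.
  by rewrite ltr_pdivrMr// ltr_pMr// ltr1n.
apply: mx_norm_le => [|i]; first by rewrite divr_ge0// ltW.
rewrite mxE normrM gtr0_norm// ler_wpM2l ?(ltW d0)//.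
set s := t 0 0; have s1 : 0 < 1 + s * s by rewrite -expr2 ltr_pwDl// sqr_ge0.
rewrite normrM normfV (gtr0_norm s1) ler_pdivrMr// ler_norml.
have := sqr_ge0 (1 - s); have := sqr_ge0 (1 + s); rewrite !expr2.
move=> h1 h2; apply/andP; split; lra.
Qed.

Lemma squash_derive d : 'D_(const_mx 1) (squash d) 0 = const_mx d.
Proof.
have ds := (squash_smooth d 1%N).1 0 I.
pose x (t : 'rV[R]_1) := t 0 0.
have dx t : differentiable x t by exact: differentiable_coord.
pose g t := (1 + x t * x t)^-1.
have dg : differentiable g 0.
  apply: differentiableV; last exact: squash_den.
  by apply: differentiableD => //; exact: differentiableM.
apply/rowP => i; rewrite -derive_coordinate// ord1.
rewrite (_ : (fun _ => _) = d *: (x * g)); last by apply/funext => t; rewrite mxE.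
have dxg : differentiable (x * g) 0 by exact: differentiableM.
rewrite deriveZ; last exact: diff_derivable.
rewrite deriveM; [|exact: diff_derivable|exact: diff_derivable].
rewrite /x mxE scale0r add0r /g /x mxE mul0r addr0 invr1 scale1r.
rewrite (derive_coordinate 0 _ (differentiable_id 0)).
rewrite derive_id !mxE; exact: mulr1.
Qed.

(** A smooth curve in coordinates, defined near 0 and starting at [x], becomes
after squashing a smooth curve in the manifold defined on the whole line. The
constant [d] may be chosen as small as wanted, so that several curves can be
given a common reparametrization. *)
Lemma chart_curve (M : manifold R) (x : M) (U : set 'rV[R]_1)
    (z : 'rV[R]_1 -> 'rV[R]_(dim M)) :
  open U -> U 0 -> smooth_on U z -> z 0 = chart_at x x ->
  exists2 e : R, 0 < e & forall d : R, 0 < d -> d <= e ->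
    (forall t : real_line R, U (squash d (const_mx t)) /\
       (chart_at x @` chart_dom (chart_at x)) (z (squash d (const_mx t)))) /\
    exists c : real_line R -> M,
    [/\ smooth c, c (0 : R) = x,
        forall t, c t = chart_inv (chart_at x) (z (squash d (const_mx t))) &
        differential c (0 : R) (const_mx 1) = d *: 'D_(const_mx 1) z 0
          :> 'rV[R]_(dim M)].
Proof.
move=> oU U0 sz z0; set ch := chart_at x; set I := ch @` chart_dom ch.
have oI : open I by exact: chart_img_open.
have I0 : I (z 0) by rewrite z0; exists x => //; exact: mem_chart_at.
have nI : \forall t \near (0 : 'rV[R]_1), I (z t).
  by apply: (sz 0%N 0 U0); exact: open_nbhs_nbhs.
have nU : \forall t \near (0 : 'rV[R]_1), U t by exact: open_nbhs_nbhs.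
have [e /= e0 eUI] := (nbhs_ballP _ _).1 (filterI nU nI).
exists e => // d d0 de.
have UI s : U (squash d s) /\ I (z (squash d s)).
  apply: eUI; rewrite -ball_normE /= sub0r normrN.
  exact: lt_le_trans (squash_bound _ d0) de.
split; first by move=> t; exact: UI.
pose b := z \o squash d.
have sb : smooth_on setT b.
  move=> k; apply: (Ck_on_comp openT _ (squash_smooth d k) (sz k)) => s _.
  exact: (UI s).1.
pose c (t : real_line R) : M := chart_inv ch (b (const_mx t)).
have cc : continuous c.
  move=> t.
  apply: (@continuous_comp _ _ _ (fun t : R => b (const_mx t)) (chart_inv ch)).
    apply: (@continuous_comp _ _ _ (fun t : R => const_mx t : 'rV[R]_1) b).
      exact: continuous_const_mx.
    exact: (sb 0%N).
  by apply: chart_inv_continuous; exact: (UI _).2.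
have E : ch \o c \o (fun v : 'rV[R]_1 => v 0 0 : R) = b.
  apply/funext => v; rewrite /= /c (_ : const_mx _ = v); last first.
    by apply/rowP => i; rewrite mxE ord1.
  by have [_ [y cy yE]] := UI v; rewrite /b /= -yE (chart_mapK cy).
have cx : c (0 : R) = x.
  by rewrite /c /b /= const_mx0 squash0 z0 chart_mapK//; exact: mem_chart_at.
have sc : smooth c.
  apply: smooth_local => // t; exists (real_chart R), ch, setT; split=> //.
  - by split=> //; exact: chart_at_atlas.
  - split=> //; have [_ [y cy yE]] := UI (const_mx t).
    by rewrite /c /b /= -yE chart_mapK.
  - by split=> //; exact: openT.
  - by rewrite /= E.
exists c; split=> //.
rewrite differential_derive// /local_rep cx -/ch /= E const_mx0.
rewrite [LHS]derive_comp; last 2 first.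
- exact: (squash_smooth d 1%N).1.
- by rewrite squash0; exact: (sz 1%N).1.
rewrite squash0 squash_derive (_ : const_mx d = d *: const_mx 1); last first.
  by apply/rowP => i; rewrite !mxE mulr1.
by rewrite !deriveE ?linearZ//; exact: (sz 1%N).1.
Qed.

Lemma exists_curve (M : manifold R) (x : M) (u : 'rV[R]_(dim M)) :
  exists (c : real_line R -> M) (k : R),
    [/\ smooth c, c (0 : R) = x, k != 0 &
        differential c (0 : R) (const_mx 1) = k *: u :> 'rV[R]_(dim M)].
Proof.
pose A : 'M[R]_(1, dim M) := u.
pose z (t : 'rV[R]_1) := t *m A + chart_at x x.
have sz : smooth_on setT z.
  move=> k; apply: Ck_onD; [exact: openT| |exact: smooth_on_cst].
  by apply: Ck_on_mulmx; [exact: openT|exact: smooth_on_id].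
have z0 : z 0 = chart_at x x by rewrite /z mul0mx add0r.
have [e e0 /(_ e e0 (lexx _))[_ [c [sc c0 _ dc]]]] := chart_curve openT I sz z0.
exists c, e; split=> //; first exact: lt0r_neq0.
have [d1 D1] := derive_mulmx A (const_mx 1) (differentiable_id 0).
rewrite dc /z deriveD; [|exact: diff_derivable|exact: derivable_cst].
by rewrite D1 derive_cst addr0 derive_id const1_mulmx.
Qed.

(** In coordinates straightened by [Psi], the submersion is the linear map [J],
and [z t = t v + (g t - q a - t v J) L] lies over [g]; since [g] has velocity
[v J] at 0, the correction through [L] has velocity 0. *)
Lemma lift_curve (N M : manifold R) (q : N -> M) (g : real_line R -> M) (n : N)
    (v : 'rV[R]_(dim N)) :
  surjective_submersion q -> smooth g -> q n = g (0 : R) ->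
  differential q n v = differential g (0 : R) (const_mx 1) :> 'rV[R]_(dim M) ->
  exists2 e : R, 0 < e & forall d : R, 0 < d -> d <= e ->
    exists c : real_line R -> N,
    [/\ smooth c, c (0 : R) = n,
        forall t, q (c t) = g (squash d (const_mx t) 0 0) &
        differential c (0 : R) (const_mx 1) = d *: v :> 'rV[R]_(dim N)].
Proof.
move=> [sq _ surj] sg qn dqv.
set a := chart_at n n.
set U := chart_at n @`
  (chart_dom (chart_at n) `&` q @^-1` chart_dom (chart_at (q n))).
have oU : open U by apply: smooth_domain_open; exact: sq.1.
have Ua : U a by exists n => //; split; exact: mem_chart_at.
have sqh : smooth_on U (local_rep q n) by apply: sq.2; exact: chart_at_atlas.
have sur w : exists v, 'D_v (local_rep q n) a = w.
  by have [u <-] := surj n w; exists u; rewrite differential_derive.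
have [W [Psi [L [[oW W0] [Psi0 dPsi] sPsi PsiP LJ]]]] :=
  submersion_straightening oU Ua sqh sur.
set J := 'J _ a in PsiP LJ.
pose gh := chart_at (q n) \o g \o (fun v : 'rV[R]_1 => v 0 0 : R).
pose V := real_chart R @` (setT `&` g @^-1` chart_dom (chart_at (q n))).
have oV : open V.
  by apply: (@smooth_domain_open _ (real_line R) _ _ (real_chart R)); exact: sg.1.
have sgh : smooth_on V gh.
  by apply: (sg.2 (real_chart R)) => //; exact: chart_at_atlas.
have V0 : V 0.
  exists (0 : R); last by apply/rowP => i; rewrite !mxE.
  by split=> //=; rewrite -qn; exact: mem_chart_at.
have gh0 : gh 0 = local_rep q n a by rewrite local_rep_at /gh /= mxE -qn.
have dgh : 'D_(const_mx 1) gh 0 = v *m J.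
  rewrite -deriveEjacobian; last exact: (sqh 1%N).1.
  rewrite -differential_derive// dqv differential_derive// /local_rep -qn /=.
  by rewrite const_mx0.
pose A : 'M[R]_(1, dim N) := v.
pose z t := t *m A + ((gh t + - local_rep q n a) + t *m - (A *m J)) *m L.
have sz : smooth_on V z.
  move=> k; apply: Ck_onD => //.
    by apply: Ck_on_mulmx => //; exact: smooth_on_id.
  apply: Ck_on_mulmx => //; apply: Ck_onD => //.
    by apply: Ck_onD => //; exact: smooth_on_cst.
  by apply: Ck_on_mulmx => //; exact: smooth_on_id.
have z0 : z 0 = 0 by rewrite /z gh0 subrr !mul0mx addr0 mul0mx addr0.
pose VW := V `&` z @^-1` W.
have oVW : open VW.
  rewrite openE => t [Vt Wt]; apply: filterI; first exact: open_nbhs_nbhs.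
  by apply: (sz 0%N t Vt); exact: open_nbhs_nbhs.
have VW0 : VW 0 by split=> //=; rewrite z0.
have sPz : smooth_on VW (Psi \o z).
  move=> k; apply: (Ck_on_comp oVW _ _ (sPsi k)) => [t []//|].
  by apply: Ck_on_sub (sz k) => t [].
have Pz0 : (Psi \o z) 0 = chart_at n n by rewrite /= z0.
have [e e0 He] := chart_curve oVW VW0 sPz Pz0.
exists e => // d d0 de; have [dom [c [sc c0 cE dc]]] := He d d0 de.
exists c; split=> //.
  move=> t; have [[Vs Ws] _] := dom t; set s := squash d (const_mx t) in Vs Ws *.
  have [Us qP] := PsiP _ Ws.
  have cU : chart_dom (chart_at n) (c t) /\ chart_dom (chart_at (q n)) (q (c t)).
    by rewrite cE -/s /=; move: Us => [y [yn yq] <-]; rewrite (chart_mapK yn).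
  have gU : chart_dom (chart_at (q n)) (g (s 0 0)).
    by move: Vs => [y [_ yg] <-]; rewrite /= mxE.
  rewrite -(chart_mapK cU.2) -(chart_mapK gU); congr chart_inv.
  have -> : chart_at (q n) (g (s 0 0)) = gh s by [].
  have -> : chart_at (q n) (q (c t)) = local_rep q n (Psi (z s)) by rewrite cE.
  rewrite qP /z mulmxDl -mulmxA -[_ *m L *m J]mulmxA LJ mulmx1 mulmxN.
  by rewrite [s *m _ + _]addrC subrK addrC subrK.
have [d1 D1] := derive_mulmx A (const_mx 1) (differentiable_id 0).
have [d2 D2] := derive_mulmx (- (A *m J)) (const_mx 1) (differentiable_id 0).
rewrite derive_id in D1 D2.
rewrite const1_mulmx in D1; rewrite const1_mulmx in D2.
have d3 : differentiable gh 0 by exact: (sgh 1%N).1.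
have d4 : differentiable (fun t => gh t + - local_rep q n a) 0.
  by apply: differentiableD => //; exact: differentiable_cst.
have d5 : differentiable (fun t => gh t + - local_rep q n a + t *m - (A *m J)) 0.
  exact: differentiableD.
have [d6 D6] := derive_mulmx L (const_mx 1) d5.
have dz : 'D_(const_mx 1) z 0 = v.
  rewrite deriveD; [|exact: diff_derivable|exact: diff_derivable].
  rewrite D6 D1 deriveD; [|exact: diff_derivable|exact: diff_derivable].
  rewrite D2 deriveD; [|exact: diff_derivable|exact: derivable_cst].
  by rewrite derive_cst addr0 dgh subrr mul0mx addr0.
rewrite dc [in LHS]derive_comp; last 2 first.
- exact: (sz 1%N).1.
- by rewrite z0; exact: (sPsi 1%N).1.
by rewrite dz z0 dPsi.
Qed.

End curves.

(** * Critical points and Hessians *)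

(** The second derivative of a composite has an additional term, the first
derivative of [f] applied to the second derivative of [F]; it vanishes because
all first derivatives of [f] do. *)
Lemma second_derive_comp {R : realType} {n m : nat} (U : set 'rV[R]_n)
    (V : set 'rV[R]_m) (F : 'rV[R]_n -> 'rV[R]_m) (f : 'rV[R]_m -> R) a v w :
  open U -> open V -> U a -> (forall x, U x -> V (F x)) -> smooth_on U F ->
  smooth_on V (fun y => const_mx (f y) : 'rV[R]_1) ->
  (forall u, 'D_u f (F a) = 0) ->
  'D_v ('D_w (f \o F)) a = 'D_('D_v F a) ('D_('D_w F a) f) (F a).
Proof.
move=> oU oV Ua UV sF sf f0.
pose fs y : 'rV[R]_1 := const_mx (f y).
have fE : f = fun y => fs y 0 0 by apply/funext => y; rewrite mxE.
have df y : V y -> differentiable f y.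
  by move=> Vy; rewrite fE; apply: differentiable_coordinate; exact: (sf 1%N).1.
pose p i y := 'D_(delta_mx 0 i) fs y 0 0.
have pE i y : V y -> p i y = 'D_(delta_mx 0 i) f y.
  by move=> Vy; rewrite /p -derive_coordinate ?fE//; exact: (sf 1%N).1.
have dp i y : V y -> differentiable (p i) y.
  by move=> Vy; apply: differentiable_coordinate; apply: ((sf 2%N).2 _).1.
have dF x : U x -> differentiable F x by exact: (sF 1%N).1.
have dDF x i : U x -> differentiable (fun x => 'D_w F x 0 i) x.
  by move=> Ux; apply: differentiable_coordinate; apply: ((sF 2%N).2 _).1.
have dpF x i : U x -> differentiable (p i \o F) x.
  by move=> Ux; apply: differentiable_comp; [exact: dF|exact: dp (UV x Ux)].
have nU : \forall x \near a, U x by exact: open_nbhs_nbhs.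
have nV : \forall y \near F a, V y by apply: open_nbhs_nbhs; split=> //; exact: UV.
have EL : \forall x \near a, 'D_w (f \o F) x =
    (\sum_i ((fun x => 'D_w F x 0 i) * (p i \o F))) x.
  apply: filterS nU => x Ux; rewrite derive_comp; [|exact: dF|exact: df (UV x Ux)].
  rewrite derive_row; last exact: df (UV x Ux).
  by rewrite fct_sumE; apply: eq_bigr => i _; rewrite -pE//; exact: UV.
have ER : \forall y \near F a, 'D_('D_w F a) f y = (\sum_i ('D_w F a 0 i *: p i)) y.
  apply: filterS nV => y Vy; rewrite derive_row; last exact: df.
  by rewrite fct_sumE; apply: eq_bigr => i _; rewrite -pE.
rewrite (near_eq_derive _ EL) (near_eq_derive _ ER).
have VFa := UV a Ua.
rewrite !derive_sum; last 2 first.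
- by move=> i; apply: diff_derivable; apply: differentiableZ; exact: dp.
- move=> i; apply: diff_derivable.
  by apply: differentiableM; [exact: dDF|exact: dpF].
apply: eq_bigr => i _.
rewrite deriveM; [|exact: diff_derivable (dDF _ _ Ua)
                  |exact: diff_derivable (dpF _ _ Ua)].
rewrite deriveZ; last exact: diff_derivable (dp _ _ VFa).
have pF0 : (p i \o F) a = 0 by rewrite /= pE.
by rewrite pF0 scale0r addr0 (derive_comp v (dF a Ua) (dp i _ VFa)).
Qed.

Section hessians.
Context {R : realType}.
Implicit Types (M N : manifold R).

(** Criticality is defined by a differential with values in row vectors, whereas
the Hessian is formed with real-valued derivatives. *)
Lemma criticalP M (f : M -> real_line R) x : smooth f ->
  critical_point f x <->
  forall u,
    'D_u (f \o chart_inv (chart_at x) : 'rV[R]_(dim M) -> R) (chart_at x x) = 0.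
Proof.
move=> sf; have df := local_rep_differentiable x sf.
have E u : differential f x u 0 0 =
    'D_u (f \o chart_inv (chart_at x) : 'rV[R]_(dim M) -> R) (chart_at x x).
  rewrite differential_derive// -derive_coordinate//.
  by congr ('D_u _ _); apply/funext => y; rewrite /local_rep /= mxE.
split=> [cf u|cf u]; first by rewrite -E cf mxE.
by apply/rowP => i; rewrite ord1 E cf mxE.
Qed.

Lemma critical_comp N M (F : N -> M) (f : M -> real_line R) n :
  smooth F -> smooth f -> critical_point f (F n) -> critical_point (f \o F) n.
Proof. by move=> sF sf cf v; rewrite differential_comp// cf. Qed.

Lemma critical_submersion N M (F : N -> M) (f : M -> real_line R) n :
  surjective_submersion F -> smooth f -> critical_point (f \o F) n ->
  critical_point f (F n).
Proof.
move=> [sF _ surj] sf cf w; have [v <-] := surj n w.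
by rewrite -differential_comp.
Qed.

Lemma hessian_comp N M (F : N -> M) (f : M -> real_line R) n
    (v w : 'rV[R]_(dim N)) :
  smooth F -> smooth f -> critical_point f (F n) ->
  hessian (f \o F) n v w = hessian f (F n) (differential F n v) (differential F n w).
Proof.
move=> sF sf /(criticalP _ sf) cf.
rewrite /hessian !(differential_derive _ _ sF).
set c := chart_at n; set d := chart_at (F n) in cf *.
pose U := c @` (chart_dom c `&` F @^-1` chart_dom d).
have oU : open U by apply: smooth_domain_open; exact: sF.1.
have Un : U (c n) by exists n => //; split; exact: mem_chart_at.
pose V := d @` (chart_dom d `&` setT).
have oV : open V by apply: chart_img_openI; exact: openT.
have UV x : U x -> V (local_rep F n x).
  move=> [y [cy dy] <-]; rewrite /local_rep /= -/c (chart_mapK cy).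
  by exists (F y).
have sFl : smooth_on U (local_rep F n) by apply: sF.2; exact: chart_at_atlas.
have sfl : smooth_on V (fun y => const_mx (f (chart_inv d y)) : 'rV[R]_1).
  by apply: (sf.2 d (real_chart R)) => //; exact: chart_at_atlas.
have nU : \forall x \near c n, U x by exact: open_nbhs_nbhs.
have Fn : local_rep F n (c n) = d (F n) by exact: local_rep_at.
rewrite -Fn -(second_derive_comp _ _ oU oV Un UV sFl sfl); last by rewrite Fn.
have E x : U x -> (f \o F \o chart_inv c : _ -> R) x =
    ((f \o chart_inv d : _ -> R) \o local_rep F n) x.
  by move=> [y [cy dy] <-]; rewrite /local_rep /= -/c (chart_mapK cy) chart_mapK.
apply: near_eq_derive.
have oo x : U x -> \forall y \near x, U y by move=> Ux; exact: open_nbhs_nbhs.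
apply: filterS nU => x /oo nx; apply: near_eq_derive.
by apply: filterS nx => y; exact: E.
Qed.

Lemma hessian_at M (f : M -> R) (x y : M) (v w : 'rV[R]_(dim M)) :
  x = y -> hessian f x v w = hessian f y v w.
Proof. by move=> ->. Qed.

Lemma hessian0l M (f : M -> R) x (w : 'rV[R]_(dim M)) :
  hessian f x (0 : 'rV[R]_(dim M)) w = 0.
Proof. exact: derive0. Qed.

End hessians.

(** * Orbits and Morita maps *)

Lemma squash_line_smooth {R : realType} (d : R) :
  smooth ((fun t => squash d (const_mx t) 0 0) : real_line R -> real_line R).
Proof.
apply: smooth_local => [t|t].
  apply: (@continuous_comp _ _ _ (fun t : R => squash d (const_mx t))
    (fun M : 'rV[R]_1 => M 0 0)).
    apply: (@continuous_comp _ _ _ (fun t : R => const_mx t : 'rV[R]_1)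
      (squash d)).
      exact: continuous_const_mx.
    exact: (squash_smooth d 0%N).
  exact: coord_continuous.
exists (real_chart R), (real_chart R), setT; split=> //.
  by split=> //; exact: openT.
rewrite (_ : _ \o _ \o _ = squash d); first exact: squash_smooth.
by apply/funext => v; apply/rowP => i; rewrite /= !mxE.
Qed.

Section groupoids.
Context {R : realType}.
Implicit Types (G H K : lie_groupoid R).

(** Compatibility with composition makes the image of a unit idempotent, and an
idempotent of a groupoid is a unit. *)
Lemma morphism_unit G H (phi : lie_morphism G H) (x : objects G) :
  on_arrows phi (unit_at x) = unit_at (on_objects phi x).
Proof.
set g := on_arrows phi (unit_at x).
have sg : source g = on_objects phi x by rewrite on_source source_unit.
have tg : target g = on_objects phi x by rewrite on_target target_unit.
have gg : mul g g = g.
  rewrite -on_mul ?source_unit ?target_unit//; congr on_arrows.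
  by rewrite -{1}(target_unit x) mul_unit_l.
have : mul (inverse g) (mul g g) = unit_at (source g) by rewrite gg mul_inverse_l.
rewrite mul_assoc ?source_inverse ?sg ?tg//.
by rewrite mul_inverse_l sg -tg mul_unit_l tg.
Qed.

(** Covered functions are basic, because source and target agree in a unit
groupoid. *)
Lemma covered_source_target G (F : real_morphism G) :
  covered F \o source = covered F \o target.
Proof.
by apply/funext => g; exact: etrans (esym (on_source F g)) (on_target F g).
Qed.

Lemma tangent_orbit_push G H (phi : lie_morphism G H) (x : objects G)
    (v : 'rV[R]_(dim (objects G))) :
  tangent_orbit x v ->
  tangent_orbit (on_objects phi x) (differential (on_objects phi) x v).
Proof.
move=> [u [su tu]].
have s1 := on_arrows_smooth phi; have s0 := on_objects_smooth phi.
have [ss _ _] := source_submersion H; have [st _ _] := target_submersion H.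
have [ss' _ _] := source_submersion G; have [st' _ _] := target_submersion G.
exists (differential (on_arrows phi) (unit_at x) u : 'rV[R]_(dim (arrows H))).
rewrite -!(differential_at _ _ (morphism_unit phi x)).
rewrite -(differential_comp _ _ s1 ss) -(differential_comp _ _ s1 st).
have -> : source \o on_arrows phi = on_objects phi \o source.
  by apply/funext => g; exact: on_source.
have -> : target \o on_arrows phi = on_objects phi \o target.
  by apply/funext => g; exact: on_target.
rewrite (differential_comp _ _ ss' s0) (differential_comp _ _ st' s0) su tu.
split; first by rewrite /differential linear0.
exact: differential_at (target_unit x).
Qed.

(** The infinitesimal form of full faithfulness, obtained by applying the
universal property to a curve of arrows of G and to lifts of its source and
target. *)
Lemma tangent_orbit_lift K G (psi : lie_morphism K G) (n : objects K)
    (v : 'rV[R]_(dim (objects K))) :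
  fully_faithful psi -> surjective_submersion (on_objects psi) ->
  tangent_orbit (on_objects psi n) (differential (on_objects psi) n v) ->
  tangent_orbit n v.
Proof.
move=> ff sub [u [su tu]].
set y := on_objects psi n in u su tu.
have [ss _ _] := source_submersion G; have [st _ _] := target_submersion G.
have [ssK _ _] := source_submersion K; have [stK _ _] := target_submersion K.
have [g [k [sg g0 k0 dg]]] := exists_curve (unit_at y) (u : 'rV[R]_(dim (arrows G))).
have [ea ea0 Ha] : exists2 e : R, 0 < e & forall d, 0 < d -> d <= e ->
    exists c : real_line R -> objects K,
    [/\ smooth c, c (0 : R) = n,
        forall t, on_objects psi (c t) = (source \o g) (squash d (const_mx t) 0 0) &
        differential c (0 : R) (const_mx 1) = d *: (0 : 'rV[R]_(dim (objects K)))
          :> 'rV[R]_(dim (objects K))].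
  apply: lift_curve => //; first exact: smooth_comp.
    by rewrite /= g0 source_unit.
  rewrite (differential_comp _ _ sg ss) dg (differential_at _ _ g0).
  rewrite differentialZ su scaler0.
  by rewrite /differential linear0.
have [eb eb0 Hb] : exists2 e : R, 0 < e & forall d, 0 < d -> d <= e ->
    exists c : real_line R -> objects K,
    [/\ smooth c, c (0 : R) = n,
        forall t, on_objects psi (c t) = (target \o g) (squash d (const_mx t) 0 0) &
        differential c (0 : R) (const_mx 1) = d *: (k *: v)
          :> 'rV[R]_(dim (objects K))].
  apply: lift_curve => //; first exact: smooth_comp.
    by rewrite /= g0 target_unit.
  rewrite (differential_comp _ _ sg st) dg (differential_at _ _ g0).
  by rewrite !differentialZ tu.
(* Source and target are lifted with the same reparametrization, so that the two
   lifts match one curve of arrows of G. *)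
pose d := Num.min ea eb.
have d0 : 0 < d by rewrite lt_min ea0.
have [a [sa a0 aE da]] := Ha d d0 ltac:(by rewrite ge_min lexx).
have [b [sb b0 bE db]] := Hb d d0 ltac:(by rewrite ge_min lexx orbT).
pose rho (t : real_line R) : real_line R := squash d (const_mx t) 0 0.
have srho : smooth rho.
  exact: squash_line_smooth.
have [h [[sh sha thb psh] _]] :=
  ff _ a b (g \o rho) sa sb (smooth_comp srho sg) aE bE.
(* Both arrows have source and target [n] and the same image, so they agree by
   uniqueness for constant families. *)
have h0 : h (0 : R) = unit_at n.
  have sc := @smooth_cst R (real_line R).
  have [h' [_ uniq]] := ff (real_line R) (fun=> n) (fun=> n) (fun=> unit_at y)
    (sc _ _) (sc _ _) (sc _ _) (fun=> esym (source_unit y))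
    (fun=> esym (target_unit y)).
  have e1 : h' = fun=> h (0 : R).
    apply: uniq; split; first exact: sc.
    - by apply/funext => t; exact: (etrans (congr1 (fun f => f (0 : R)) sha) a0).
    - by apply/funext => t; exact: (etrans (congr1 (fun f => f (0 : R)) thb) b0).
    - apply/funext => t; rewrite /= -[RHS]g0.
      apply: (etrans (congr1 (fun f => f (0 : R)) psh)) => /=; congr g.
      by rewrite /rho !mxE mul0r mulr0.
  have e2 : h' = fun=> unit_at n.
    apply: uniq; split; first exact: sc.
    - by apply/funext => t /=; rewrite source_unit.
    - by apply/funext => t /=; rewrite target_unit.
    - by apply/funext => t /=; rewrite morphism_unit.
  by have := congr1 (fun f => f (0 : R)) (etrans (esym e1) e2).
have dk : d * k != 0 by rewrite mulf_neq0// gt_eqF.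
exists ((d * k)^-1 *: differential h (0 : R) (const_mx 1) : 'rV[R]_(dim (arrows K))).
rewrite -!(differential_at _ _ h0) !differentialZ.
rewrite -(differential_comp _ _ sh ssK) -(differential_comp _ _ sh stK).
rewrite sha thb da db scaler0 scaler0; split=> //.
by rewrite [d *: _]scalerA scalerA mulVf// scale1r.
Qed.

End groupoids.

Theorem proposition3p8 (R : realType) (G G' K : lie_groupoid R)
    (phi : lie_morphism K G) (psi : lie_morphism K G')
    (phi_morita : morita_map phi) (psi_morita : morita_map psi)
    (phi_submersion : surjective_submersion (on_objects phi))
    (psi_submersion : surjective_submersion (on_objects psi))
    (F' : real_morphism G') (F : real_morphism G)
    (F_of_F' : forall n : objects K,
       covered F (on_objects phi n) = covered F' (on_objects psi n)) :
  morse F' -> morse F.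
Proof.
move=> morseF' _ [x0 crit0 ->] x [g [gx <-]]; rewrite -gx in crit0.
have sF : smooth (covered F) := on_objects_smooth F.
have sF' : smooth (covered F') := on_objects_smooth F'.
have crit : critical_point (covered F) (target g).
  apply: (critical_submersion (target_submersion G) sF).
  rewrite -covered_source_target; apply: (critical_comp _ sF crit0).
  by have [] := source_submersion G.
have [sphi /(_ (target g))[n nx] surphi] := phi_submersion.
rewrite -nx in crit *.
have [spsi _ surpsi] := psi_submersion.
have E : covered F \o on_objects phi = covered F' \o on_objects psi.
  by apply/funext => m; exact: F_of_F'.
have crit' : critical_point (covered F') (on_objects psi n).
  apply: (critical_submersion psi_submersion sF').
  by rewrite -E; exact: critical_comp.
apply/seteqP; split=> v.
  move=> Hv; have [u uv] := surphi n v; rewrite -uv in Hv *.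
  apply: tangent_orbit_push; apply: (tangent_orbit_lift psi_morita.1 psi_submersion).
  rewrite -(morseF' (orbit_of (on_objects psi n)) _ (on_objects psi n) _).
  - move=> w'; have [w <-] := surpsi n w'.
    rewrite -(hessian_comp _ _ spsi sF' crit') -E (hessian_comp _ _ sphi sF crit).
    exact: Hv.
  - by exists (on_objects psi n).
  - by exists (unit_at (on_objects psi n)); rewrite source_unit target_unit.
set y := on_objects phi n in crit v *.
(* orbit directions: compare the Hessians of the equal functions
   [covered F \o source] and [covered F \o target] at the unit *)
move=> [u [su tu]] w.
have [ss _ _] := source_submersion G; have [st _ surt] := target_submersion G.
have [w' tw] := surt (unit_at y) (w : 'rV[R]_(dim (objects G))).
rewrite -(hessian_at _ _ _ (target_unit y)) -tu -tw.
have critt : critical_point (covered F) (target (unit_at y)) by rewrite target_unit.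
have crits : critical_point (covered F) (source (unit_at y)) by rewrite source_unit.
rewrite -(hessian_comp _ _ st sF critt) -covered_source_target.
by rewrite (hessian_comp _ _ ss sF crits) su hessian0l.
Qed.
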